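(* Let $\rho:\mathfrak g\to\mathfrak{gl}(V)$ be a representation of a finite-dimensional complex Lie algebra $\mathfrak g$ on a finite-dimensional complex vector space $V$. Assume that $f_1,\dots,f_q$ are algebraically independent invariant polynomials of $\rho$, numbered so that $\deg f_1\le\dots\le\deg f_q$, where $q=\operatorname{codim}\mathcal O_{\mathrm{reg}}$. Let $\mathsf v_1(\rho)\le\dots\le\mathsf v_q(\rho)$ be the vertical indices of $\rho$. Then the following conditions are equivalent: 1. The degrees of the $f_i$ are equal to the vertical indices of $\rho$: $\deg f_i=\mathsf v_i(\rho)$ for all $i=1,\dots,q$. 2. The sum of the degrees of the $f_i$ is equal to the total vertical index of $\rho$: $\sum_{i=1}^q\deg f_i=\sum_{i=1}^q\mathsf v_i(\rho)$. 3. The set of points $x\in V$ where the differentials $df_1(x),\dots,df_q(x)$ are linearly dependent has codimension $\ge 2$ in $V$. 4. The set of points $x\in V$ where the differentials $df_1(x),\dots,df_q(x)$ are linearly dependent is contained in the set $\mathsf{Sing}_1$, i.e. in the codimension $\ge 2$ stratum of the set $\mathsf{Sing}$ of singular points of $\rho$ in $V$.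
   Context: All objects are over $\mathbb C$. Jordan–Kronecker form: for linear maps $A,B:U\to W$ of finite-dimensional spaces there are bases of $U$ and $W$ in which every $A+\lambda B$ is block-diagonal with blocks $A_i+\lambda B_i$ of the following types, the number and types of blocks being unique up to permutation: (1) Jordan block with eigenvalue $\lambda_0\in\mathbb C$: $A_i$ is a square upper triangular Jordan block with eigenvalue $\lambda_0$ and $B_i=-I$; (2) Jordan block with eigenvalue $\infty$: $A_i=I$ and $B_i=-N$, where $N$ is the nilpotent Jordan block; (3) horizontal Kronecker block of size $(h-1)\times h$, $h\ge 1$: $A_i=(0\mid I_{h-1})$, $B_i=-(I_{h-1}\mid 0)$; (4) vertical Kronecker block of size $v\times(v-1)$, $v\ge1$: $A_i=\binom{0}{I_{v-1}}$, $B_i=-\binom{I_{v-1}}{0}$. A zero $m\times n$ block is regarded as $m$ vertical blocks of size $1\times0$ and $n$ horizontal blocks of size $0\times1$. The vertical indices of the pencil are the heights $v$ of its vertical Kronecker blocks. For $x\in V$ let $R_x:\mathfrak g\to V$, $R_x(\xi)=\rho(\xi)x$. There is a non-empty Zariski open set of pairs $(a,b)\in V\times V$ (generic pairs) for which the types and sizes of the blocks of the pencil $R_a+\lambda R_b$ (up to the values of the eigenvalues) are one and the same. The vertical indices of $\rho$ are those of $R_a+\lambda R_b$ for generic $(a,b)$; their number is $\operatorname{codim}\mathcal O_{\mathrm{reg}}$, and the total vertical index of $\rho$ is their sum. Put $r=\dim\mathcal O_{\mathrm{reg}}=\max_{x\in V}\operatorname{rk}R_x$ and $\operatorname{codim}\mathcal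 O_{\mathrm{reg}}=\dim V-r$. The set of singular points is $\mathsf{Sing}=\{x\in V:\operatorname{rk}R_x<r\}$. Let $p_1,\dots,p_N\in\mathbb C[V]$ be those $r\times r$ minors of the matrix of $R_x$ that do not vanish identically, let $\mathsf p_\rho=\gcd(p_1,\dots,p_N)$, and write $p_i=\mathsf p_\rho h_i$. Then $\mathsf{Sing}=\mathsf{Sing}_0\cup\mathsf{Sing}_1$, where $\mathsf{Sing}_0=\{x\in V:\mathsf p_\rho(x)=0\}$ and $\mathsf{Sing}_1=\{x\in V: h_i(x)=0,\ i=1,\dots,N\}$; the latter has codimension $\ge2$. An invariant polynomial is $f\in\mathbb C[V]$ with $df(x)(\rho(\xi)x)=0$ for all $x\in V$, $\xi\in\mathfrak g$.
   Formalization: Conditions 3 and 4 are shown to imply 1 and 2 only for homogeneous f_i (false otherwise: rho = 0 on C^2, f_1 = x, f_2 = y + x^2); the equivalences 1⇔2, 3⇔4 and the implication 2⇒3 are proved for arbitrary f_i. *)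

(* Defs.v *)
From HB Require Import structures.
From mathcomp Require Import all_boot all_order all_algebra.
From mathcomp Require Import boolp classical_sets reals.
From mathcomp Require Import complex mpoly.

Set Implicit Arguments.
Unset Strict Implicit.
Unset Printing Implicit Defensive.

Import GRing.Theory.
Local Open Scope ring_scope.
Local Open Scope classical_set_scope.

Section Lie.
Variables (F : fieldType) (g V : vectType F).

Record lie_bracket (br : g -> g -> g) : Prop := LieBracket {
  lie_linearl : forall a x y z, br (a *: x + y) z = a *: br x z + br y z;
  lie_linearr : forall a x y z, br z (a *: x + y) = a *: br z x + br z y;
  lie_alternating : forall x, br x x = 0;
  lie_jacobi : forall x y z, br x (br y z) + br y (br z x) + br z (br x y) = 0
}.

Definition lie_representation (br : g -> g -> g) (rho : {linear g -> 'End(V)}) :=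
  forall x y, rho (br x y) = (rho x \o rho y)%VF - (rho y \o rho x)%VF.

Definition Rmap (rho : {linear g -> 'End(V)}) (x : V) : 'Hom(g, V) :=
  linfun (fun xi => rho xi x).

Lemma RmapE rho x xi : Rmap rho x xi = rho xi x.
Proof.
have lin : linear (fun xi => rho xi x).
  by move=> a u w; rewrite linearP add_lfunE scale_lfunE.
pose h := GRing.isLinear.Build F g V _ _ lin.
pose k : {linear g -> V} := HB.pack (fun xi => rho xi x) h.
by rewrite /Rmap (lfunE k).
Qed.

Definition dim_Oreg (rho : {linear g -> 'End(V)}) : nat :=
  (\max_(k < (\dim {:V}).+1 | `[< exists x, \dim (limg (Rmap rho x)) = k >]) k)%N.

Definition codim_Oreg (rho : {linear g -> 'End(V)}) : nat :=
  (\dim {:V} - dim_Oreg rho)%N.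

End Lie.

(* The matrix of a linear map, acting on columns of coordinates. *)
Definition lfun_mx (F : fieldType) (U W : vectType F) (m n : nat)
    (eU : m.-tuple U) (eW : n.-tuple W) (f : 'Hom(U, W)) : 'M[F]_(n, m) :=
  \matrix_(i, j) coord eW i (f (tnth eU j)).

(* The parameter k of a block is one less than its size parameter, so that     *)
(* empty blocks are excluded: Jordan blocks have size k.+1, a horizontal block *)
(* has h = k.+1 columns and a vertical block has v = k.+1 rows.                *)
Inductive jk_block (F : Type) :=
  | Jordan of F & nat
  | JordanInf of nat
  | Horizontal of nat
  | Vertical of nat.
Arguments JordanInf {F} k.
Arguments Horizontal {F} k.
Arguments Vertical {F} k.

Section JordanKronecker.
Variable F : fieldType.
Implicit Types (b : jk_block F) (bs : seq (jk_block F)).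

Definition block_rows b : nat :=
  match b with
  | Jordan _ k | JordanInf k | Vertical k => k.+1
  | Horizontal k => k
  end.

Definition block_cols b : nat :=
  match b with
  | Jordan _ k | JordanInf k | Horizontal k => k.+1
  | Vertical k => k
  end.

Definition blockA b : 'M[F]_(block_rows b, block_cols b) :=
  \matrix_(i, j)
    match b with
    | Jordan a _ => a *+ (j == i :> nat) + (j == i.+1 :> nat)%:R
    | JordanInf _ => (j == i :> nat)%:R
    | Horizontal _ => (j == i.+1 :> nat)%:R
    | Vertical _ => (i == j.+1 :> nat)%:R
    end.

Definition blockB b : 'M[F]_(block_rows b, block_cols b) :=
  \matrix_(i, j)
    match b with
    | Jordan _ _ | Horizontal _ | Vertical _ => - (j == i :> nat)%:R
    | JordanInf _ => - (j == i.+1 :> nat)%:R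
    end.

Definition jk_rows bs : nat := sumn (map block_rows bs).
Definition jk_cols bs : nat := sumn (map block_cols bs).

Fixpoint jk_mx (lambda : F) bs : 'M[F]_(jk_rows bs, jk_cols bs) :=
  match bs with
  | [::] => 0
  | b :: bs' => block_mx (blockA b + lambda *: blockB b) 0 0 (jk_mx lambda bs')
  end.

Definition jk_form (U W : vectType F) (A B : 'Hom(U, W)) bs : Prop :=
  exists (eU : (jk_cols bs).-tuple U) (eW : (jk_rows bs).-tuple W),
    [/\ basis_of {:U} eU, basis_of {:W} eW
      & forall lambda, lfun_mx eU eW (A + lambda *: B) = jk_mx lambda bs].

Definition block_type b : jk_block unit :=
  match b with
  | Jordan _ k => Jordan tt k
  | JordanInf k => JordanInf k
  | Horizontal k => Horizontal k
  | Vertical k => Vertical k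
  end.

End JordanKronecker.

Definition vertical_heights (E : Type) (bs : seq (jk_block E)) : seq nat :=
  pmap (fun b => if b is Vertical k then Some k.+1 else None) bs.

Section Zariski.
Variables (F : fieldType) (T : Type) (n : nat).
(* A system of coordinates on T; T is V or V * V below. *)
Variable crd : T -> 'I_n -> F.
Implicit Types Z D : set T.

Definition zariski_closed Z : Prop :=
  exists S : set {mpoly F[n]}, Z = [set x | forall p, S p -> p.@[crd x] = 0].

Definition zariski_irreducible Z : Prop :=
  [/\ zariski_closed Z, Z !=set0
    & forall Z1 Z2, zariski_closed Z1 -> zariski_closed Z2 ->
        Z `<=` Z1 `|` Z2 -> Z `<=` Z1 \/ Z `<=` Z2].

(* The codimension of an irreducible closed Z is the supremum of the lengths   *)
(* of chains of irreducible closed sets going up from Z; the codimension of a  *)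
(* closed D is the infimum of codim Z over the irreducible closed Z in D (so   *)
(* that the empty set has codimension >= k for every k).                       *)
Definition codim_ge (k : nat) D : Prop :=
  forall Z, zariski_irreducible Z -> Z `<=` D ->
    exists c : nat -> set T,
      [/\ c 0%N = Z,
          forall i, (i <= k)%N -> zariski_irreducible (c i)
        & forall i, (i < k)%N -> c i `<` c i.+1].

End Zariski.

Section Polynomials.
Variables (F : fieldType) (n : nat).
Implicit Types p d : {mpoly F[n]}.

(* The total degree; msize is the total degree plus one (and 0 for p = 0). *)
Definition degree p : nat := (msize p).-1.

Definition mpdvd d p : Prop := exists c, p = d * c.

Definition is_gcd (S : set {mpoly F[n]}) d : Prop :=
  (forall p, S p -> mpdvd d p) /\
  (forall d', (forall p, S p -> mpdvd d' p) -> mpdvd d' d).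

Definition alg_independent (q : nat) (f : q.-tuple {mpoly F[n]}) : Prop :=
  forall P : {mpoly F[q]}, P \mPo f = 0 -> P = 0.

End Polynomials.

(* The ring of polynomial functions on V is {mpoly F[n]}, through the          *)
(* coordinates in a basis e of V.                                              *)
Section Representation.
Variables (F : fieldType) (g V : vectType F) (m n : nat).
Variables (eg : m.-tuple g) (e : n.-tuple V) (rho : {linear g -> 'End(V)}).

Definition coords (x : V) (i : 'I_n) : F := coord e i x.

Definition pair_coords (ab : V * V) (k : 'I_(n + n)) : F :=
  match split k with
  | inl i => coords ab.1 i
  | inr i => coords ab.2 i
  end.

Definition differential (f : {mpoly F[n]}) (x : V) : 'Hom(V, F^o) :=
  \sum_(i < n) f^`M(i).@[coords x] *: linfun (coord e i : V -> F^o).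

Definition invariant_poly (f : {mpoly F[n]}) : Prop :=
  forall x xi, differential f x (rho xi x) = 0.

Definition dependent_locus (q : nat) (f : q.-tuple {mpoly F[n]}) : set V :=
  [set x | ~~ free [tuple differential (tnth f i) x | i < q]].

(* The matrix of R_x in the bases eg and e, with entries in the polynomial     *)
(* ring: R_x = sum_k x_k R_(e_k).                                              *)
Definition Rmx : 'M[{mpoly F[n]}]_(n, m) :=
  \matrix_(i, j) \sum_(k < n) lfun_mx eg e (Rmap rho (tnth e k)) i j *: 'X_k.

Definition nonzero_minors : set {mpoly F[n]} :=
  [set p | p != 0 /\
     exists (I : 'I_(dim_Oreg rho) -> 'I_n) (J : 'I_(dim_Oreg rho) -> 'I_m),
       [/\ {homo I : i j / (i < j)%N}, {homo J : i j / (i < j)%N}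
         & p = \det (mxsub I J Rmx)]].

(* d stands for the gcd of the nonzero minors, which is determined up to a     *)
(* nonzero scalar; Sing1 does not depend on this choice.                       *)
Definition Sing1 (d : {mpoly F[n]}) : set V :=
  [set x | forall h, nonzero_minors (d * h) -> h.@[coords x] = 0].

(* vs lists the vertical indices of rho, in any order: on a non-empty Zariski  *)
(* open set of pairs (a, b) the block types ts of R_a + lambda R_b are         *)
(* constant, and vs are the heights of the vertical ones.                      *)
Definition vertical_indices (vs : seq nat) : Prop :=
  exists (O : set (V * V)) (ts : seq (jk_block unit)),
    [/\ zariski_closed pair_coords (~` O), O !=set0,
        forall a b, O (a, b) ->
          exists2 bs, jk_form (Rmap rho a) (Rmap rho b) bs
                    & map (@block_type F) bs = ts
      & perm_eq vs (vertical_heights ts)].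

End Representation.

(* Main.v *)
From HB Require Import structures.
Require Import Defs.
From mathcomp Require Import all_boot all_order all_algebra.
From mathcomp Require Import fingroup perm.
From mathcomp Require Import boolp classical_sets reals.
From mathcomp Require Import complex mpoly zify.

(** Let J(x) be the q x n matrix with rows df_1(x), ..., df_q(x) and let D
be the dependent locus, where J(x) drops rank. The idea is to follow the
differentials along a line a + t b. Invariance says that df_i(a + t b),
whose entries are polynomials in t of degree less than deg f_i,
annihilates the image of R_a + t R_b. For a generic pair (a, b) this
pencil has a Jordan-Kronecker form with q vertical blocks, of heights
v_1, ..., v_q. A polynomial covector killed by it vanishes outside the
vertical blocks and is c_j(t) (1, t, ..., t^(v_j - 1)) on the j-th one
(pencil_left_kernel, top_coefficients). So the differentials are encoded
in a q x q matrix C of polynomials with deg C_ij + v_j <= deg f_i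
whenever C_ij is nonzero, and a + t b lies in D exactly when det C(t) =
0.

Conditions 1 and 2. Algebraically independent polynomials in
characteristic 0 have generically independent differentials
(jacobian_criterion), so det C is a nonzero polynomial. A nonzero term
of its expansion is a permutation s with v_(s i) <= deg f_i for all i;
after sorting, v_i <= deg f_i (degrees_ge). Hence the degrees equal the
indices as soon as their sums are equal.

From 2 to 3. The degree of det C is at most the sum of the deg f_i minus
the sum of the v_i. If the sums agree, det C is a nonzero constant and a
generic line misses D. But a generic line meets every hypersurface, so D
contains none (sum_eq_codim).

From 3 to 2, for homogeneous f_i. If D has codimension at least 2 then a
generic line misses D (lines_avoid_dependent_locus), so det C is a
nonzero constant. By homogeneity the differentials at b + t a are t^(deg
f_i - 1) times those at a + t^-1 b; comparing the minors formed by the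
bottom rows of the vertical blocks, the minor at b + t a is a constant
times t to the power sum deg f_i - sum v_i. At t = 0 it is nonzero since
b is not in D, so the exponent is 0 (pencil_degrees_sum).

Conditions 3 and 4. The quotients h of the nonzero r x r minors of R_x
by their gcd have no common factor, so Sing1 has codimension at least 2
and so does every subset (Sing1_codim). Conversely J annihilates the
columns of the matrix of R_x, so that its q x q minors are proportional
to the complementary r x r minors in any r columns
(complementary_minors). If the q x q minors have no common factor, each
h is a multiple of a q x q determinant that vanishes on D
(annihilated_minor_divisible).

The geometry used is that the common zeros of polynomials, not all of
them zero, have codimension at least 2 if and only if no prime
polynomial divides them all. It rests on unique factorization
(mpoly_factorial) and on the Nullstellensatz for a hypersurface
(hypersurface_nullstellensatz). The latter, like the statement on lines
avoiding D, comes from elimination in K[x][t] after the substitution of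
x + t b for x (line_elimination). *)

Set Implicit Arguments.
Unset Strict Implicit.
Unset Printing Implicit Defensive.

Import GRing.Theory Num.Theory.
Local Open Scope ring_scope.
Local Open Scope classical_set_scope.

(** * Unique factorization *)

Section Factorial.
Variable R : idomainType.
Implicit Types (a b d p : R) (s : seq R).

(** For polynomials this is convertible with mpdvd; the general form is
needed because the proof moves between polynomial rings over different
domains. *)
Definition divides (d a : R) : Prop := exists c, a = d * c.

Definition prime_element (p : R) : Prop :=
  [/\ p != 0, p \isn't a GRing.unit
    & forall a b, divides p (a * b) -> divides p a \/ divides p b].

Lemma divides_mulr d a b : divides d a -> divides d (a * b).
Proof. by case=> c ->; exists (c * b); rewrite mulrA. Qed.

Lemma divides_mull d a b : divides d b -> divides d (a * b).
Proof. by rewrite mulrC; apply: divides_mulr. Qed.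

Lemma divides_refl d : divides d d.
Proof. by exists 1; rewrite mulr1. Qed.

Lemma divides_trans a b d : divides d a -> divides a b -> divides d b.
Proof. by case=> c -> [c' ->]; exists (c * c'); rewrite mulrA. Qed.

Lemma divides_add d a b : divides d a -> divides d b -> divides d (a + b).
Proof. by case=> c -> [c' ->]; exists (c + c'); rewrite mulrDr. Qed.

Lemma divides_opp d a : divides d a -> divides d (- a).
Proof. by case=> c ->; exists (- c); rewrite mulrN. Qed.

Lemma divides0 d : divides d 0.
Proof. by exists 0; rewrite mulr0. Qed.

Lemma divides_pmul2l c d a : c != 0 -> divides (c * d) (c * a) -> divides d a.
Proof.
by move=> c0 [k]; rewrite -mulrA => /(mulfI c0) ->; exists k.
Qed.

Lemma prime_not_divides_unit p u :
  prime_element p -> u \is a GRing.unit -> ~ divides p u.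
Proof.
case=> _ pNu _ uu [c eu]; case/negP: pNu.
by move: uu; rewrite eu unitrM => /andP[].
Qed.

Lemma prime_divides_unitM p u a :
  prime_element p -> u \is a GRing.unit -> divides p (u * a) -> divides p a.
Proof.
move=> pp uu; case: (pp) => _ _ /[apply] -[] //.
by move/(prime_not_divides_unit pp uu).
Qed.

Lemma prime_divides_prod p s :
  prime_element p -> divides p (\prod_(x <- s) x) ->
  exists2 x, x \in s & divides p x.
Proof.
move=> pp; elim: s => [|x s IHs]; rewrite ?big_nil ?big_cons.
  by move/(prime_not_divides_unit pp (unitr1 _)).
case: (pp) => _ _ /[apply] -[px|/IHs[y ys py]].
  by exists x; rewrite ?mem_head.
by exists y; rewrite // in_cons ys orbT.
Qed.

Lemma prime_divides_prime p p' : prime_element p -> prime_element p' ->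
  divides p p' -> exists2 u, u \is a GRing.unit & p' = p * u.
Proof.
move=> pp [p'0 p'Nu p'P] [c p'E]; exists c => //.
have [|[k pE]|[k cE]] := p'P p c; first by rewrite -p'E; exact: divides_refl.
  have /eqP: p * (c * k) = p * 1 by rewrite mulr1 mulrA -p'E.
  case: pp => p0 _ _; rewrite (inj_eq (mulfI p0)) => /eqP ck1.
  by apply/unitrPr; exists k.
case: pp => _ /negP[]; apply/unitrPr; exists k.
have c0 : c != 0 by apply: contraNneq p'0; rewrite p'E => ->; rewrite mulr0.
apply: (mulfI c0); rewrite mulr1 {2}cE p'E.
by rewrite mulrCA mulrA.
Qed.

(** Uniqueness is not part of the definition: it follows because the factors
are required to be prime, not merely irreducible. *)
Definition factorial_domain : Prop := forall a, a != 0 ->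
  exists u s, [/\ u \is a GRing.unit, forall p, p \in s -> prime_element p
                & a = u * \prod_(p <- s) p].

(** Remove the prime factors of w one at a time: a prime factor p fails to
divide some t in T but divides t * u, hence divides u. *)
Lemma coprime_cancel (T : R -> Prop) (w u : R) :
  factorial_domain -> w != 0 ->
  (forall p, prime_element p -> ~ forall t, T t -> divides p t) ->
  (forall t, T t -> divides w (t * u)) -> divides w u.
Proof.
move=> fR /fR[c [s [cu sP ->]]] copT.
suff main v : (forall t, T t -> divides (\prod_(p <- s) p) (t * v)) ->
    divides (\prod_(p <- s) p) v.
  move=> Tu; case: (main u) => [t /Tu[k ->]|k ->].
    by exists (c * k); rewrite -mulrA mulrCA.
  by exists (c^-1 * k); rewrite mulrACA divrr // mul1r.
elim: s sP v => [|p s IHs] sP v; first by exists v; rewrite big_nil mul1r.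
have pp : prime_element p by apply: sP; rewrite mem_head.
rewrite big_cons => Tv.
have [t [Tt pNt]] : exists t, T t /\ ~ divides p t.
  apply: contrapT => /forallNP ex; apply: (copT p pp) => t Tt.
  by apply: contrapT => pt; apply: (ex t).
have [k vE] : divides p v.
  case: (pp) => _ _ /(_ t v) [] //.
  by apply: divides_trans (Tv t Tt); exists (\prod_(p <- s) p).
rewrite vE; case: (IHs _ k) => [x xs|x Tx|j ->].
- by apply: sP; rewrite in_cons xs orbT.
- apply: (@divides_pmul2l p); first by case: pp.
  by rewrite mulrCA -vE; apply: Tv.
- by exists j; rewrite mulrA.
Qed.

End Factorial.

Section FactorialPoly.
Variable R : idomainType.
Hypothesis fR : factorial_domain R.
Implicit Types (p : R) (f g h : {poly R}).

Lemma dividesC_coef p g i : divides p%:P g -> divides p g`_i.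
Proof. by case=> k ->; rewrite coefCM; exists k`_i. Qed.

(** If p divides g * h it divides the product of the constant terms, so it
divides one of them; that term can be discarded and the remaining factor
divided by 'X, which lowers the total size. *)
Lemma polyC_prime p : prime_element p -> prime_element p%:P.
Proof.
move=> pp; have [p0 pNu pP] := pp; split.
- by rewrite polyC_eq0.
- by rewrite poly_unitE coefC eqxx size_polyC p0.
move=> g h; have [n] := ubnP (size g + size h); elim: n g h => // n IHn g h.
have XdvdP (k : {poly R}) : divides p%:P (k * 'X) -> divides p%:P k.
  elim/poly_ind: k => [|k c _ pk]; first by move=> _; exact: divides0.
  case: pk => l /[dup] E /(congr1 (fun q : {poly R} => q`_0)).
  rewrite coefMX coefCM /= => /esym/eqP; rewrite mulf_eq0 (negPf p0) /= =>
    /eqP l0.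
  exists (\poly_(i < size l) l`_i.+1); apply/polyP => i.
  have /(congr1 (fun q : {poly R} => q`_i.+1)) := E.
  rewrite coefMX /= !coefCM => ->; congr (_ * _).
  by rewrite coef_poly; case: ltnP => // lei;
    rewrite nth_default // (leq_trans lei).
have step (k l : {poly R}) (c : R) :
  (size (k * 'X + c%:P)%R + size l < n.+1)%N ->
    k * 'X + c%:P != 0 ->
    divides p c -> divides p%:P ((k * 'X + c%:P) * l) ->
    divides p%:P (k * 'X + c%:P) \/ divides p%:P l.
  move=> szk nz [c' cE]; rewrite cE in szk nz * => pkl.
  have pc : divides p%:P (p * c')%:P by exists c'%:P; rewrite polyCM.
  have [->|k0] := eqVneq k 0; first by rewrite mul0r add0r; left.
  have szE : size (k * 'X + (p * c')%:P) = (size k).+1.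
    by rewrite size_MXaddC (negPf k0).
  have [] := IHn k l.
  - by move: szk; rewrite szE addSn ltnS.
  - apply: XdvdP; rewrite -mulrA [l * _]mulrC mulrA.
    rewrite -[_ * l](addrK ((p * c')%:P * l)) -mulrDl.
    by apply: divides_add => //; apply: divides_opp; apply: divides_mulr.
  - by move=> pk; left; apply: divides_add => //; apply: divides_mulr.
  - by right.
have [->|g0] := eqVneq g 0; first by move=> _ _; left; exact: divides0.
have [->|h0] := eqVneq h 0; first by move=> _ _; right; exact: divides0.
elim/poly_ind: g g0 => [|g c _] g0; first by rewrite eqxx in g0.
elim/poly_ind: h h0 => [|h d _] h0; first by rewrite eqxx in h0.
move=> sz pgh.
have /pP[pc|pd] : divides p (c * d).
  have := dividesC_coef 0 pgh.
  by rewrite coef0M !coefD !coefMX !coefC !add0r.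
  exact: step.
have [] := step h (g * 'X + c%:P) d; rewrite 1?addnC // 1?mulrC //.
  by right.
by left.
Qed.

Definition primitive f : Prop := forall p, prime_element p -> ~ divides p%:P f.

(** Each prime pulled out of f removes one prime factor of the leading
coefficient, so the process stops. *)
Lemma exists_primitive f : f != 0 -> exists c f', f = c%:P * f' /\ primitive f'.
Proof.
move=> f0; have /fR[u [s [uu sP lf]]] :
  lead_coef f != 0 by rewrite lead_coef_eq0.
have [n] := ubnP (size s); elim: n f s f0 u uu sP lf =>
  // n IHn f s f0 u uu sP lf szs.
have [prf|] := pselect (primitive f).
  by exists 1, f; rewrite mul1r.
move/existsNP=> [p /not_implyP[pp /contrapT [f1 fE]]].
have p0 : p != 0 by case: pp.
have f10 : f1 != 0 by apply: contraNneq f0; rewrite fE => ->; rewrite mulr0.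
have lfE : lead_coef f = p * lead_coef f1 by rewrite fE lead_coefM lead_coefC.
have [x xs] : exists2 x, x \in s & divides p x.
  apply: prime_divides_prod => //; apply: (prime_divides_unitM pp uu).
  by rewrite -lf lfE; exists (lead_coef f1).
move=> /(prime_divides_prime pp (sP x xs)) [c cu xE].
have [||||c' [f' [f1E prf']]] := IHn f1 (rem x s) f10 (u * c).
- by rewrite unitrM uu cu.
- by move=> y /mem_rem; exact: sP.
- apply: (mulfI p0); rewrite -lfE lf (big_rem x xs) /= xE.
  by rewrite !mulrA; congr (_ * _); rewrite -!mulrA mulrCA.
- by move: szs; rewrite (perm_size (perm_to_rem xs)).
by exists (p * c'), f'; split=> //; rewrite polyCM -mulrA -f1E.
Qed.

(** Gauss's lemma in the form used below: a factorization of f up to a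
constant a becomes a factorization of f, because each prime factor of a
divides g or h by polyC_prime. *)
Lemma clear_factor (a : R) f g h : primitive f -> a != 0 -> a%:P * f = g * h ->
  exists g' h', [/\ f = g' * h', size g' = size g & size h' = size h].
Proof.
move=> prf /fR[u [s [uu sP ->]]].
elim: s sP u uu g h => [|p s IHs] sP u uu g h.
  rewrite big_nil mulr1 => E; exists (u^-1%:P * g), h; split=> //.
    by rewrite -mulrA -E mulrA -polyCM mulVr // mul1r.
  by rewrite size_Cmul // invr_eq0; apply: contraTneq uu => ->; rewrite unitr0.
have pp : prime_element p by apply: sP; rewrite mem_head.
have p0 : p != 0 by case: pp.
have pP0 : p%:P != 0 :> {poly R} by rewrite polyC_eq0.
have sP' : forall x, x \in s -> prime_element x.
  by move=> x xs; apply: sP; rewrite in_cons xs orbT.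
rewrite big_cons mulrCA polyCM -mulrA => E.
have : divides p%:P (g * h) by rewrite -E; eexists.
case: (polyC_prime pp) => _ _ /[apply] -[[g1 gE]|[h1 hE]].
  move: E; rewrite gE -mulrA =>
    /(mulfI pP0) /(IHs sP' u uu)[g' [h' [-> sg sh]]].
  by exists g', h'; rewrite size_Cmul.
move: E; rewrite hE [g * _]mulrCA =>
  /(mulfI pP0) /(IHs sP' u uu)[g' [h' [-> sg sh]]].
by exists g', h'; rewrite size_Cmul.
Qed.

Import Pdiv.Idomain.

(** Pseudo-division over an integral domain only shows that f divides a
multiple a * g; primes of a cannot divide the primitive f, so they are
cancelled against the quotient. *)
Lemma primitive_divides f g : primitive f -> f %| g -> divides f g.
Proof.
move=> prf /Pdiv.Idomain.dvdpP[[a k] /= a0]; rewrite -mul_polyC.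
move: a0 => /fR[u [s [uu sP ->]]].
elim: s sP u uu k => [|p s IHs] sP u uu k.
  rewrite big_nil mulr1 => E; exists (u^-1%:P * k).
  by rewrite mulrCA [f * k]mulrC -E mulrA -polyCM mulVr // mul1r.
have pp : prime_element p by apply: sP; rewrite mem_head.
have p0 : p != 0 by case: pp.
have pP0 : p%:P != 0 :> {poly R} by rewrite polyC_eq0.
have sP' : forall x, x \in s -> prime_element x.
  by move=> x xs; apply: sP; rewrite in_cons xs orbT.
rewrite big_cons mulrCA polyCM -mulrA => E.
have : divides p%:P (k * f) by rewrite -E; eexists.
case: (polyC_prime pp) => _ _ /[apply] -[[k1 kE]|]; last by move/prf: pp.
by move: E; rewrite kE -mulrA => /(mulfI pP0) /(IHs sP' u uu).
Qed.

(** Induction on the degree. A primitive f that does not split into factors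
of smaller degree is prime: its gcd with g, computed by pseudo-division,
has degree 0 or deg f, so that f divides h by Gauss's lemma in the first
case and g in the second. *)
Theorem factorial_poly : factorial_domain {poly R}.
Proof.
move=> f; have [n] := ubnP (size f); elim: n f => // n IHn f szf f0.
have [c [f' [fE prf]]] := exists_primitive f0.
have c0 : c != 0 by apply: contraNneq f0; rewrite fE => ->; rewrite mul0r.
have f'0 : f' != 0 by apply: contraNneq f0; rewrite fE => ->; rewrite mulr0.
have [u [s [uu sP cE]]] := fR c0.
suff [v [t [vu tP f'E]]] : exists (v : {poly R}) (t : seq {poly R}),
    [/\ v \is a GRing.unit, forall x, x \in t -> prime_element x
      & f' = v * \prod_(x <- t) x].
  exists (u%:P * v), (map polyC s ++ t); split.
  - by rewrite unitrM vu andbT poly_unitE coefC eqxx uu size_polyC andbT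
      (contraTneq _ uu) // => ->; rewrite unitr0.
  - move=> p; rewrite mem_cat => /orP[/mapP[x /sP xP ->]|/tP //].
    exact: polyC_prime.
  - rewrite fE cE f'E polyCM big_cat big_map /= rmorph_prod /=.
    by rewrite -!mulrA; congr (_ * _); rewrite mulrCA.
have szf' : size f' = size f by rewrite fE size_Cmul.
have [[g [h [f'E szg szh]]]|irr] := pselect (exists g h,
    [/\ f' = g * h, (size g < size f')%N & (size h < size f')%N]).
  have g0 : g != 0 by apply: contraNneq f'0; rewrite f'E => ->; rewrite mul0r.
  have h0 : h != 0 by apply: contraNneq f'0; rewrite f'E => ->; rewrite mulr0.
  have [|v [t [vu tP gE]]] := IHn g _ g0.
    by apply: leq_trans szg _; rewrite szf' -ltnS.
  have [|w [r [wu rP hE]]] := IHn h _ h0.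
    by apply: leq_trans szh _; rewrite szf' -ltnS.
  exists (v * w), (t ++ r); split; first by rewrite unitrM vu.
    by move=> p; rewrite mem_cat => /orP[/tP|/rP].
  by rewrite f'E gE hE big_cat /= mulrACA.
have [f'u|f'Nu] := boolP (f' \is a GRing.unit).
  by exists f', [::]; rewrite big_nil mulr1.
exists 1, [:: f']; rewrite big_seq1 mul1r unitr1; split=> // p.
rewrite inE => /eqP ->{p}; split=> // g h [k ghE].
have f'gh : f' %| g * h by rewrite ghE dvdp_mulIl.
have /Pdiv.Idomain.dvdpP[[a l] /= a0 E] := dvdp_gcdl f' g.
have aP0 : a%:P * f' != 0 by rewrite mulf_neq0 ?polyC_eq0.
have l0 : l != 0 by apply: contraNneq aP0; rewrite mul_polyC E => ->;
  rewrite mul0r.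
have d0 : gcdp f' g != 0 by rewrite gcdp_eq0 (negPf f'0).
have szE : (size l + size (gcdp f' g)).-1 = size f'.
  by rewrite -size_mul // -E size_scale.
have [l' [d' [f'E szl szd]]] := clear_factor prf a0 (etrans (mul_polyC _ _) E).
have szl0 : (0 < size l)%N by rewrite size_poly_gt0.
have szd0 : (0 < size (gcdp f' g))%N by rewrite size_poly_gt0.
have [szd1|szd1] := eqVneq (size (gcdp f' g)) 1.
  right; apply: primitive_divides => //.
  by rewrite -(@Gauss_dvdpr _ _ g) // /coprimep szd1.
have [szl1|szl1] := eqVneq (size l) 1.
  left; apply: primitive_divides => //.
  apply: dvdp_trans (dvdp_gcdr f' g).
  have /size_poly1P[c1 c10 lE] : size l == 1%N by rewrite szl1.
  by rewrite -(@dvdpZr _ c1) // -mul_polyC -lE -E dvdpZr.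
case: irr; exists l', d'; split=> //; rewrite ?szl ?szd -szE; lia.
Qed.

End FactorialPoly.

Section Elimination.
Variable R : idomainType.

Import Pdiv.Idomain.

(** A prime P of R[t] is coprime to F over the fraction field of R; clearing
denominators in a Bezout relation leaves a nonzero constant of R. *)
Lemma prime_bezout (P F : {poly R}) : prime_element P -> ~ divides P F ->
  exists2 d : R, d != 0 & exists u v : {poly R}, u * P + v * F = d%:P.
Proof.
move=> [P0 PNu PP] PNF; have [szP|szP] := leqP (size P) 1.
  exists P`_0; first by rewrite -polyC_eq0 -size1_polyC.
  by exists 1, 0; rewrite mul1r mul0r addr0 -size1_polyC.
have cNdiv (c : R) : c != 0 -> ~ divides P c%:P.
  move=> c0 [k ck]; have k0 : k != 0.
    by apply: contraNneq c0 => k0; rewrite -polyC_eq0 ck k0 mulr0.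
  have := congr1 (fun g : {poly R} => size g) ck;
    rewrite size_polyC c0 size_mul //.
  by move: szP k0; rewrite -size_poly_gt0; lia.
suff /Bezout_coprimepP[[u v] /= uv] : coprimep P F.
  have /size_poly1P[d d0 dE] : size (u * P + v * F) == 1%N.
    by rewrite (eqp_size uv) size_poly1.
  by exists d => //; exists u, v.
have d0 : gcdp P F != 0 by rewrite gcdp_eq0 (negPf P0).
have /dvdpP[[a l] /= a0 E] := dvdp_gcdl P F.
have /dvdpP[[c k] /= c0 E'] := dvdp_gcdr P F.
have : divides P (l * gcdp P F) by rewrite -E -mul_polyC mulrC; exists a%:P.
case/PP => [[l' lE]|Pg]; last first.
  have : divides P (c%:P * F) by rewrite mul_polyC E'; exact: divides_mull.
  by case/PP => // /cNdiv; rewrite c0; case.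
have : P * (l' * gcdp P F) = P * a%:P by rewrite mulrA -lE -E -mul_polyC mulrC.
move/(mulfI P0) => /(congr1 (fun g : {poly R} => size g)).
have l'0 : l' != 0.
  apply: contraNneq P0 => l'0; have /eqP := E; rewrite lE l'0 mulr0 mul0r.
  by rewrite -mul_polyC mulf_eq0 polyC_eq0 (negPf a0).
rewrite size_mul // size_polyC a0 /coprimep.
by move: l'0 d0; rewrite -!size_poly_gt0; lia.
Qed.

(** A Bezout constant vanishes wherever a specialization of R makes P and F
share a zero. *)
Lemma prime_elimination (P F : {poly R}) : prime_element P -> ~ divides P F ->
  exists2 d : R, d != 0 & forall (S : comNzRingType) (e : {rmorphism R -> S})
    (t : S),
    (map_poly e P).[t] = 0 -> (map_poly e F).[t] = 0 -> e d = 0.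
Proof.
move=> pP PNF; have [d d0 [u [v E]]] := prime_bezout pP PNF; exists d =>
  // S e t P0 F0.
have := congr1 (fun g => (map_poly e g).[t]) E.
by rewrite rmorphD !rmorphM /= hornerD !hornerM P0 F0 !mulr0 addr0 map_polyC
  hornerC.
Qed.

End Elimination.

Section Transport.
Variables (R S : idomainType) (phi : {rmorphism R -> S})
  (psi : {rmorphism S -> R}).
Hypotheses (phiK : cancel phi psi) (psiK : cancel psi phi).

Lemma divides_rmorph d a : divides d a -> divides (phi d) (phi a).
Proof. by case=> c ->; exists (phi c); rewrite rmorphM. Qed.

Lemma iso_divides d a : divides (phi d) (phi a) -> divides d a.
Proof. by case=> c E; exists (psi c); rewrite -[a]phiK E rmorphM /= phiK. Qed.

Lemma iso_prime p : prime_element p -> prime_element (phi p).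
Proof.
case=> p0 pNu pP; split.
- by rewrite -(rmorph0 phi) (can_eq phiK).
- by apply: contra pNu => /(rmorph_unit psi); rewrite phiK.
move=> x y; rewrite -{1}[x]psiK -{1}[y]psiK -rmorphM =>
  /iso_divides/pP[]/divides_rmorph.
  by rewrite psiK; left.
by rewrite psiK; right.
Qed.

Lemma iso_factorial : factorial_domain R -> factorial_domain S.
Proof.
move=> fR b b0; have /fR[u [s [uu sP E]]] : psi b != 0.
  by rewrite -(rmorph0 psi) (can_eq psiK).
exists (phi u), (map phi s); split; first exact: rmorph_unit.
  by move=> _ /mapP[p /sP pp ->]; exact: iso_prime.
by rewrite -[b]psiK E rmorphM rmorph_prod big_map.
Qed.

End Transport.

(** Polynomial rings are free: this replaces every computation with
monomials in the comparison of substitutions below. *)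
Lemma mpoly_rmorph_ext (K : comNzRingType) (S : nzRingType) n
    (f g : {rmorphism {mpoly K[n]} -> S}) :
  (forall c, f c%:MP = g c%:MP) -> (forall i, f 'X_i = g 'X_i) -> f =1 g.
Proof.
move=> eqC eqX p; rewrite (mpolyE p) !rmorph_sum; apply: eq_bigr => m _.
rewrite -mul_mpolyC !rmorphM eqC; congr (_ * _).
by rewrite mpolyXE_id !rmorph_prod; apply: eq_bigr => i _;
  rewrite !rmorphXn /= eqX.
Qed.

Section FirstVariable.
Variables (K : idomainType) (n : nat).

Definition split_var (i : 'I_n.+1) : {poly {mpoly K[n]}} :=
  if unlift ord0 i is Some j then ('X_j)%:P else 'X.

Definition to_poly : {mpoly K[n.+1]} -> {poly {mpoly K[n]}} :=
  mmap (polyC \o @mpolyC n K) split_var.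

HB.instance Definition _ := GRing.RMorphism.copy to_poly
  (mmap (polyC \o @mpolyC n K) split_var).

Definition lift_vars : {mpoly K[n]} -> {mpoly K[n.+1]} :=
  mmap (@mpolyC n.+1 K) (fun j => 'X_(lift ord0 j)).

HB.instance Definition _ := GRing.RMorphism.copy lift_vars
  (mmap (@mpolyC n.+1 K) (fun j => 'X_(lift ord0 j))).

Definition of_poly : {poly {mpoly K[n]}} -> {mpoly K[n.+1]} :=
  horner_eval 'X_ord0 \o map_poly lift_vars.

HB.instance Definition _ := GRing.RMorphism.copy of_poly
  (horner_eval 'X_ord0 \o map_poly lift_vars).

Lemma to_polyK : cancel to_poly of_poly.
Proof.
move=> p; apply: (mpoly_rmorph_ext (f := of_poly \o to_poly) (g := idfun)) =>
  [c|i] /=.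
  by rewrite /to_poly mmapC /of_poly /= map_polyC /= /horner_eval hornerC
    /lift_vars mmapC.
rewrite /to_poly mmapX mmap1U /split_var /of_poly /=; case: unliftP => [j|] ->
  /=.
  by rewrite map_polyC /= /horner_eval hornerC /lift_vars mmapX mmap1U.
by rewrite map_polyX /horner_eval hornerX.
Qed.

Lemma of_polyK : cancel of_poly to_poly.
Proof.
have liftK p : to_poly (lift_vars p) = p%:P.
  apply: (mpoly_rmorph_ext (f := to_poly \o lift_vars) (g := polyC)) =>
    [c|i] /=.
    by rewrite /lift_vars mmapC /to_poly mmapC.
  rewrite /lift_vars mmapX mmap1U /to_poly mmapX mmap1U /split_var.
  by rewrite liftK.
elim/poly_ind => [|p c IHp]; first by rewrite !rmorph0.
rewrite !rmorphD !rmorphM /= IHp; congr (_ * _ + _).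
  rewrite /of_poly /= map_polyX /horner_eval hornerX /to_poly mmapX mmap1U.
  by rewrite /split_var unlift_none.
by rewrite /of_poly /= map_polyC /= /horner_eval hornerC liftK.
Qed.

End FirstVariable.

Theorem mpoly_factorial (K : fieldType) n : factorial_domain {mpoly K[n]}.
Proof.
elim: n => [|n IHn]; last first.
  exact: iso_factorial (@of_polyK K n) (@to_polyK K n) (factorial_poly IHn).
move=> p p0; exists p, [::]; rewrite big_nil mulr1; split=> //.
rewrite (nvar0_mpolyC p) rmorph_unit // unitfE.
by apply: contraNneq p0 => e; rewrite (nvar0_mpolyC p) e mpolyC0.
Qed.

(** * Polynomials on lines *)

Section Lines.
Variables (K : fieldType) (n : nat).
Implicit Types (x y b : 'I_n -> K) (p f : {mpoly K[n]}).

Definition line x y : {mpoly K[n]} -> {poly K} :=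
  mmap polyC (fun i => (x i)%:P + y i *: 'X).

HB.instance Definition _ x y := GRing.RMorphism.copy (line x y)
  (mmap polyC (fun i => (x i)%:P + y i *: 'X)).

Lemma lineC x y c : line x y c%:MP = c%:P.
Proof. exact: mmapC. Qed.

Lemma lineX x y i : line x y 'X_i = (x i)%:P + y i *: 'X.
Proof. by rewrite /line mmapX mmap1U. Qed.

Lemma horner_line x y p t : (line x y p).[t] = p.@[fun i => x i + t * y i].
Proof.
apply: (mpoly_rmorph_ext (f := horner_eval t \o line x y)
          (g := meval (fun i => x i + t * y i))) => [c|i] /=.
  by rewrite lineC /horner_eval hornerC mevalC.
by rewrite lineX mevalXU /horner_eval !hornerE mulrC.
Qed.

Lemma size_line x y p : (size (line x y p) <= msize p)%N.
Proof.
rewrite /line /mmap; apply: (leq_trans (size_sum _ _ _)).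
rewrite msizeE; apply/bigmax_leqP_seq => m mp _; rewrite mul_polyC.
apply: leq_trans (size_scale_leq _ _) _.
apply: leq_trans (@leq_bigmax_seq _ _ _ (fun m => (mdeg m).+1) _ mp isT).
rewrite /mmap1 mdegE.
elim/big_rec2: _ => [|i q k _ IH]; first by rewrite size_poly1.
have szh : (size ((x i)%:P + y i *: 'X)%R <= 2)%N.
  apply: leq_trans (size_polyD _ _) _; rewrite geq_max.
  rewrite (leq_trans (size_polyC_leq1 _)) //.
  by rewrite (leq_trans (size_scale_leq _ _)) ?size_polyX.
have szX : (size (((x i)%:P + y i *: 'X) ^+ m i)%R <= (m i).+1)%N.
  apply: leq_trans (size_poly_exp_leq _ _) _;
    rewrite ltnS -[leqRHS]mul1n leq_mul2r.
  by rewrite -subn1 leq_subLR szh orbT.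
apply: leq_trans (size_polyMleq _ _) _.
by rewrite -subn1 leq_subLR add1n -addSn -addnS leq_add.
Qed.

(** Substitution of x + t b for x, with t a new variable. *)
Definition sweep b : {mpoly K[n]} -> {poly {mpoly K[n]}} :=
  mmap (polyC \o @mpolyC n K) (fun i => ('X_i)%:P + (b i)%:MP *: 'X).

HB.instance Definition _ b := GRing.RMorphism.copy (sweep b)
  (mmap (polyC \o @mpolyC n K) (fun i => ('X_i)%:P + (b i)%:MP *: 'X)).

Lemma sweepC b c : sweep b c%:MP = c%:MP%:P.
Proof. exact: mmapC. Qed.

Lemma sweepX b i : sweep b 'X_i = ('X_i)%:P + (b i)%:MP *: 'X.
Proof. by rewrite /sweep mmapX mmap1U. Qed.

Lemma sweep_line x b p : map_poly (meval x) (sweep b p) = line x b p.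
Proof.
apply: (mpoly_rmorph_ext (f := map_poly (meval x) \o sweep b)
          (g := line x b)) => [c|i] /=.
  by rewrite sweepC lineC map_polyC /= mevalC.
by rewrite sweepX lineX rmorphD /= map_polyC /= linearZ /= map_polyX mevalXU
  mevalC.
Qed.

(** The automorphism of K[x][t] that fixes t and sends x to x + t b. It
turns constants in t into sweeps, hence carries primality of p over to
its sweep. *)
Definition shear b : {poly {mpoly K[n]}} -> {poly {mpoly K[n]}} :=
  horner_eval 'X \o map_poly (sweep b).

HB.instance Definition _ b := GRing.RMorphism.copy (shear b)
  (horner_eval 'X \o map_poly (sweep b)).

Lemma shearC b p : shear b p%:P = sweep b p.
Proof. by rewrite /shear /= map_polyC /= /horner_eval hornerC. Qed.

Lemma shearX b : shear b 'X = 'X.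
Proof. by rewrite /shear /= map_polyX /horner_eval hornerX. Qed.

Lemma shear_sweep b c p : (forall i, b i + c i = 0) ->
  shear b (sweep c p) = p%:P.
Proof.
move=> bc0; apply: (mpoly_rmorph_ext (f := shear b \o sweep c)
   (g := polyC)) => [k|i] /=.
  by rewrite sweepC shearC sweepC.
rewrite sweepX -mul_polyC rmorphD rmorphM /= !shearC shearX sweepC sweepX.
rewrite mul_polyC -addrA -scalerDl -mpolyCD bc0 mpolyC0 scale0r addr0 //.
Qed.

Lemma shearMXaddC b g p : shear b (g * 'X + p%:P) = shear b g * 'X + sweep b p.
Proof. by rewrite rmorphD rmorphM /= shearX shearC. Qed.

Lemma shearK b c : (forall i, b i + c i = 0) -> cancel (shear c) (shear b).
Proof.
move=> bc0; elim/poly_ind => [|g k IHg]; first by rewrite !rmorph0.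
rewrite shearMXaddC rmorphD rmorphM /= IHg shearX.
by rewrite shear_sweep.
Qed.

Lemma sweep_prime b p : prime_element p -> prime_element (sweep b p).
Proof.
have bN i : - b i + b i = 0 by rewrite addNr.
have Nb i : b i + - b i = 0 by rewrite subrr.
by move=> /polyC_prime/(iso_prime (shearK bN) (shearK Nb)); rewrite /= shearC.
Qed.

Lemma sweep_divides b p f : divides (sweep b p) (sweep b f) -> divides p f.
Proof.
have bN i : - b i + b i = 0 by rewrite addNr.
rewrite -!shearC => /(iso_divides (shearK bN))/(dividesC_coef 0).
by rewrite !coefC.
Qed.

(** The points x whose line in direction b meets the common zeros of p and f
lie on a proper hypersurface d = 0. This elimination is the source of
both the Nullstellensatz for hypersurfaces and of lines that avoid a set
of codimension 2. *)
Lemma line_elimination b p f : prime_element p -> ~ divides p f ->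
  exists2 d : {mpoly K[n]}, d != 0
    & forall x t, p.@[fun i => x i + t * b i] = 0 ->
     f.@[fun i => x i + t * b i] = 0 -> d.@[x] = 0.
Proof.
move=> pp pNf; have PNF : ~ divides (sweep b p)
  (sweep b f) by move/sweep_divides.
have [d d0 dP] := prime_elimination (sweep_prime b pp) PNF.
exists d => // x t px fx; apply: (dP K (meval x) t).
  by rewrite sweep_line horner_line.
by rewrite sweep_line horner_line.
Qed.

End Lines.

(** * Hypersurfaces and codimension two *)

Lemma poly_nonroot (K : numDomainType) (p : {poly K}) : p != 0 ->
  exists t, p.[t] != 0.
Proof.
move=> p0; apply: contrapT => /forallNP nr.
have := @max_poly_roots _ p [seq i%:R | i <- iota 0 (size p)] p0.
rewrite size_map size_iota ltnn => H; apply: notF; apply: H.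
  by apply/allP => x _; apply/negPn/negP/nr.
by rewrite map_inj_uniq ?iota_uniq // => i j /eqP; rewrite eqr_nat => /eqP.
Qed.

Lemma meval_to_poly (K : idomainType) n (p : {mpoly K[n.+1]})
  (x : 'I_n -> K) t :
  (map_poly (meval x) (to_poly p)).[t] =
    p.@[fun i => if unlift ord0 i is Some j then x j else t].
Proof.
pose y i := if unlift ord0 i is Some j then x j else t.
apply: (mpoly_rmorph_ext (f := horner_eval t \o map_poly
  (meval x) \o @to_poly K n)
          (g := meval y)) => [c|i] /=.
  by rewrite /to_poly mmapC /= map_polyC /horner_eval hornerC /= !mevalC.
rewrite /to_poly mmapX mmap1U /split_var mevalXU /y /horner_eval.
by case: unliftP => [j|] _; rewrite ?map_polyC ?map_polyX /= ?hornerC ?hornerX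
  ?mevalXU.
Qed.

Lemma mpoly_nonroot (K : numDomainType) n (p : {mpoly K[n]}) :
  p != 0 -> exists x, p.@[x] != 0.
Proof.
elim: n p => [|n IHn] p p0.
  exists (fun _ => 0); rewrite (nvar0_mpolyC p) mevalC.
  by apply: contraNneq p0 => e; rewrite (nvar0_mpolyC p) e mpolyC0.
have P0 : to_poly p != 0 by rewrite -(rmorph0 (@to_poly K n))
  (can_eq (@to_polyK K n)).
have [x xP] : exists x, (lead_coef (to_poly p)).@[x] != 0.
  by apply: IHn; rewrite lead_coef_eq0.
have [t] : exists t, (map_poly (meval x) (to_poly p)).[t] != 0.
  apply: poly_nonroot; apply: contraNneq xP =>
    /(congr1 (fun g : {poly K} => g`_(size (to_poly p)).-1)).
  by rewrite coef_map coef0 => ->.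
by rewrite meval_to_poly; eexists; eassumption.
Qed.

Lemma mpoly_eq0_meval (K : numDomainType) n (p : {mpoly K[n]}) :
  (forall x, p.@[x] = 0) -> p = 0.
Proof. by move=> p0; apply: contrapT => /eqP/mpoly_nonroot[x];
  rewrite p0 eqxx. Qed.

Section Hypersurfaces.
Variables (K : numClosedFieldType) (n : nat).
Implicit Types (x b : 'I_n -> K) (p f : {mpoly K[n]}).

Definition diff_along b p : {mpoly K[n]} :=
  p \mPo [tuple 'X_i + (b i)%:MP | i < n] - p.

Lemma meval_diff_along b p x :
  (diff_along b p).@[x] = p.@[fun i => x i + b i] - p.@[x].
Proof.
rewrite mevalB comp_mpoly_meval; congr (_ - _); apply: meval_eq => i.
by rewrite tnth_mktuple mevalD mevalXU mevalC.
Qed.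

(** A polynomial that takes two values on a line is not constant there, so
it has a root on it. *)
Lemma line_root x b p : p.@[fun i => x i + b i] != p.@[x] ->
  exists t, p.@[fun i => x i + t * b i] = 0.
Proof.
move=> pxb; have : size (line x b p) != 1%N.
  apply: contraNneq pxb => /eqP/size_poly1P[c _ E].
  have -> : p.@[x] = (line x b p).[0].
    by rewrite horner_line; apply: meval_eq => i; rewrite mul0r addr0.
  have -> : p.@[fun i => x i + b i] = (line x b p).[1].
    by rewrite horner_line; apply: meval_eq => i; rewrite mul1r.
  by rewrite E !hornerC.
case/closed_rootP => t /rootP; rewrite horner_line => pt; by exists t.
Qed.

Lemma nonconstant_values p : prime_element p ->
  exists x b, p.@[fun i => x i + b i] != p.@[x].
Proof.
case=> p0 pNu _; pose c := p.@[fun _ => 0].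
have [x xP] : exists x, (p - c%:MP).@[x] != 0.
  apply: mpoly_nonroot; rewrite subr_eq0; apply: contraNneq pNu => pc.
  by rewrite pc rmorph_unit // unitfE -(mpolyC_eq0 n) -pc.
exists (fun _ => 0), x; move: xP; rewrite mevalB mevalC subr_eq0.
by congr (_ != _); apply: meval_eq => i; rewrite add0r.
Qed.

(** If p does not divide f, choose a direction b along which p is not
constant, and a line outside the elimination hypersurface on which p
still varies: p has a root on this line, and f cannot vanish at it. *)
Theorem hypersurface_nullstellensatz p f : prime_element p ->
  (forall x, p.@[x] = 0 -> f.@[x] = 0) -> divides p f.
Proof.
move=> pp pf; apply: contrapT => pNf.
have [x0 [b x0b]] := nonconstant_values pp.
have [d d0 dP] := line_elimination b pp pNf.
have [x] : exists x, (d * diff_along b p).@[x] != 0.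
  apply: mpoly_nonroot; rewrite mulf_neq0 //.
  apply: contraNneq x0b => E; have := meval_diff_along b p x0.
  by rewrite E meval0 => /esym/eqP; rewrite subr_eq0.
rewrite mevalM meval_diff_along mulf_eq0 negb_or subr_eq0 =>
  /andP[dx /line_root[t pt]].
by case/eqP: dx; apply: (dP x t) => //; apply: pf.
Qed.

End Hypersurfaces.

Section Codimension.
Variables (K : numClosedFieldType) (n : nat) (T : Type) (crd : T -> 'I_n -> K).
Hypothesis crd_surj : forall x, exists v, crd v =1 x.
Implicit Types (p f : {mpoly K[n]}) (Z D : set T).

Definition hypersurface f : set T := [set v | f.@[crd v] = 0].

Lemma hypersurface_closed f : zariski_closed crd (hypersurface f).
Proof.
exists [set f]; rewrite eqEsubset; split=> v /=; first by move=> fv _ ->.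
by apply.
Qed.

Lemma hypersurface_divides p f : prime_element p ->
  hypersurface p `<=` hypersurface f -> divides p f.
Proof.
move=> pp pf; apply: hypersurface_nullstellensatz => // x.
have [v vx] := crd_surj x; rewrite -!(meval_eq _ vx); exact: pf.
Qed.

Lemma divides_hypersurface p f : divides p f ->
  hypersurface p `<=` hypersurface f.
Proof. by move=> [k ->] v /= pv; rewrite /hypersurface /= mevalM pv mul0r. Qed.

Lemma zeros_irreducible (Z : set T) : zariski_closed crd Z -> Z !=set0 ->
  (forall f g, Z `<=` hypersurface (f * g) ->
    Z `<=` hypersurface f \/ Z `<=` hypersurface g) ->
  zariski_irreducible crd Z.
Proof.
move=> Zcl Z0 ZP; split=> // Z1 Z2 [S1 ->] [S2 ->] Z12.
apply: contrapT => /not_orP[/existsNP[v1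
  /not_implyP[Zv1 /existsNP[f1 /not_implyP[S1f fv1]]]]].
move=> /existsNP[v2 /not_implyP[Zv2 /existsNP[f2 /not_implyP[S2f fv2]]]].
have [|/(_ v1 Zv1)|/(_ v2 Zv2)] := ZP f1 f2 => //.
move=> v /Z12[] /= Sv; rewrite /hypersurface /= mevalM.
  by rewrite Sv // mul0r.
by rewrite [X in _ * X]Sv // mulr0.
Qed.

Lemma hypersurface_irreducible p : prime_element p ->
  zariski_irreducible crd (hypersurface p).
Proof.
move=> pp; apply: zeros_irreducible; first exact: hypersurface_closed.
  apply: contrapT => /nonemptyPn Z0.
  have /(hypersurface_divides pp) :
    hypersurface p `<=` hypersurface 1 by rewrite Z0.
  exact: prime_not_divides_unit (unitr1 _).
move=> f g /(hypersurface_divides pp); case: (pp) => _ _ /[apply].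
by case=> /divides_hypersurface; [left|right].
Qed.

Lemma setT_irreducible : zariski_irreducible crd setT.
Proof.
apply: zeros_irreducible.
- by exists set0; rewrite eqEsubset; split=> [v _ p []|v _].
- by have [v _] := crd_surj (fun _ => 0); exists v.
have T0 f : setT `<=` hypersurface f -> f = 0.
  move=> f0; apply: mpoly_eq0_meval => x; have [v vx] := crd_surj x.
  by rewrite -(meval_eq _ vx); exact: f0.
move=> f g /T0/eqP; rewrite mulf_eq0 => /orP[]/eqP->; [left|right];
  by move=> v _; rewrite /hypersurface /= meval0.
Qed.

(** An irreducible set inside the zeros of a product lies in the zeros of a
factor. *)
Lemma irreducible_sub_prime Z f : zariski_irreducible crd Z -> f != 0 ->
  Z `<=` hypersurface f ->
  exists p, [/\ prime_element p, divides p f & Z `<=` hypersurface p].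
Proof.
move=> [_ [v0 Zv0] ZP] f0; have [u [s [uu sP ->]]] := mpoly_factorial f0.
elim: s sP => [|p s IHs] sP ZfP.
  move: uu (ZfP v0 Zv0); rewrite /hypersurface /= big_nil mulr1.
  by move=> /(rmorph_unit (meval (crd v0))); rewrite unitfE => /negPf nz /eqP;
    rewrite nz.
have pp : prime_element p by apply: sP; rewrite mem_head.
have [|||sub|sub] := ZP (hypersurface p) (hypersurface (u * \prod_(q <- s) q)).
- exact: hypersurface_closed.
- exact: hypersurface_closed.
- move=> v /ZfP; rewrite /hypersurface /= big_cons mulrCA mevalM => /eqP.
  by rewrite mulf_eq0 => /orP[]/eqP; [left|right].
- by exists p; split=> //; rewrite big_cons mulrCA; apply: divides_mulr; exact:
  divides_refl.
have [|q [qp qd Zq]] := IHs _ sub; first by move=> x xs; apply: sP;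
  rewrite in_cons xs orbT.
by exists q; split=> //; rewrite big_cons mulrCA; apply: divides_mull.
Qed.

(** An irreducible Z inside D lies in the hypersurface of some prime factor
p of a nonzero element of S. It is not the whole of it, as p would then
divide all of S; so Z, the hypersurface and the whole space form the
required chain. *)
Lemma coprime_codim_ge2 (S : set {mpoly K[n]}) D :
  (exists2 f, S f & f != 0) ->
  (forall p, prime_element p -> ~ forall f, S f -> divides p f) ->
  (forall f, S f -> D `<=` hypersurface f) -> codim_ge crd 2 D.
Proof.
move=> [f0 Sf0 f0N0] copS SD Z Zirr ZD.
have [p [pp _ Zp]] := irreducible_sub_prime Zirr f0N0
  (subset_trans ZD (SD _ Sf0)).
exists (fun i => if i is i'.+1 then if i' is _.+1 then setT else hypersurface p
  else Z).
split=> //.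
  case=> [|[|i]] //= _; [exact: hypersurface_irreducible|exact:
    setT_irreducible].
case=> [|[|//]] _ /=; split=> //.
- move=> pZ; apply: (copS p pp) => f Sf; apply: hypersurface_divides => //.
  exact: subset_trans pZ (subset_trans ZD (SD _ Sf)).
- case: (pp) => p0 _ _; have [x /eqP px] := mpoly_nonroot p0.
  by have [v vx] := crd_surj x => /(_ v I);
    rewrite /hypersurface /= (meval_eq _ vx).
Qed.

(** The first step of a chain above the hypersurface of p would be an
irreducible proper closed set, hence inside the hypersurface of a prime
q; then p divides q, the two hypersurfaces agree and the step is not
strict. *)
Lemma codim_ge2_no_hypersurface p D : prime_element p -> codim_ge crd 2 D ->
  ~ hypersurface p `<=` D.
Proof.
move=> pp codD /(codD _ (hypersurface_irreducible pp))[c [c0 cirr cinc]].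
have [[S c1E] _ _] := cirr 1%N isT.
have [_ c12] := cinc 1%N isT.
have [f [f0 c1f]] : exists f, f != 0 /\ c 1%N `<=` hypersurface f.
  have /existsNP[v /not_implyP[_ vNc1]] : ~ c 2%N `<=` c 1%N by [].
  have /existsNP[f /not_implyP[Sf fv]] : ~ (forall f, S f -> f.@[crd v] = 0).
    by move=> H; apply: vNc1; rewrite c1E.
  exists f; split; first by apply: contra_notN fv => /eqP->; rewrite meval0.
  by move=> w; rewrite c1E /=; apply.
have [q [qp qf c1q]] := irreducible_sub_prime (cirr 1%N isT) f0 c1f.
have [c01 Nc10] := cinc 0%N isT; rewrite c0 in c01 Nc10.
have /(hypersurface_divides pp) pq : hypersurface p `<=` hypersurface q.
  exact: subset_trans c01 c1q.
have [u uu qE] := prime_divides_prime pp qp pq.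
apply: Nc10; apply: subset_trans c1q _; apply: divides_hypersurface.
by rewrite qE; exists u^-1; rewrite mulrK.
Qed.

Lemma codim_geS k D D' : D' `<=` D -> codim_ge crd k D -> codim_ge crd k D'.
Proof. by move=> D'D codD Z Zirr ZD'; apply: codD => //;
  apply: subset_trans D'D. Qed.

End Codimension.

(** * Algebraic dependence *)

Lemma comp_mpoly_tnth (K : fieldType) n M (h : M.-tuple {mpoly K[n]}) i :
  'X_i \mPo h = tnth h i.
Proof. by rewrite comp_mpolyXU -tnth_nth. Qed.

Section Composition.
Variables (K : fieldType) (n M : nat).
Implicit Types (P : {mpoly K[M]}) (h : M.-tuple {mpoly K[n]}).

Lemma eq_comp_mpoly_msupp P h h' :
  (forall m k, m \in msupp P -> m k != 0%N -> tnth h k = tnth h' k) ->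
  P \mPo h = P \mPo h'.
Proof.
move=> hh'; rewrite !comp_mpolyE !big_seq; apply: eq_bigr => m mP.
congr (_ *: _); apply: eq_bigr => k _.
by have [->|/(hh' m k mP) ->] := eqVneq (m k) 0%N; rewrite ?expr0.
Qed.

Lemma comp_mpoly_comp k P h (h' : n.-tuple {mpoly K[k]}) :
  (P \mPo h) \mPo h' = P \mPo [tuple tnth h i \mPo h' | i < M].
Proof.
apply: (mpoly_rmorph_ext (f := comp_mpoly h' \o comp_mpoly h)
   (g := comp_mpoly [tuple tnth h i \mPo h' | i < M])) => [c|i] /=.
  by rewrite !comp_mpolyC.
by rewrite !comp_mpoly_tnth tnth_mktuple.
Qed.

(** The chain rule. Both sides are derivations in P, so it is enough to
check constants and variables. *)
Lemma mderiv_comp P h k :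
  (P \mPo h)^`M(k) = \sum_(l < M) (P^`M(l) \mPo h) * (tnth h l)^`M(k).
Proof.
pose chain P := (P \mPo h)^`M(k) = \sum_(l < M) (P^`M(l) \mPo h) *
  (tnth h l)^`M(k).
have chainM p q : chain p -> chain q -> chain (p * q).
  rewrite /chain => Hp Hq; rewrite rmorphM mderivM /= Hp Hq.
  rewrite mulr_suml mulr_sumr -big_split; apply: eq_bigr => l _ /=.
  rewrite mderivM rmorphD !rmorphM mulrDl /=; congr (_ + _).
    by rewrite mulrAC.
  by rewrite mulrA.
have chainC c : chain c%:MP.
  rewrite /chain comp_mpolyC mderivC big1 // => l _.
  by rewrite mderivC comp_mpoly0 mul0r.
have chainX i : chain 'X_i.
  rewrite /chain comp_mpoly_tnth (bigD1 i) //= big1 => [|l li].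
    by rewrite mderivX mnm1E eqxx -{1}[U_(i)%MM]add0m addmK mpolyX0 scale1r
      comp_mpoly1 mul1r addr0.
  by rewrite mderivX mnm1E eq_sym (negPf li) scale0r comp_mpoly0 mul0r.
have chainD p q : chain p -> chain q -> chain (p + q).
  rewrite /chain => Hp Hq; rewrite comp_mpolyD mderivD Hp Hq -big_split.
  by apply: eq_bigr => l _ /=; rewrite mderivD comp_mpolyD mulrDl.
suff: chain P by [].
rewrite (mpolyE P); apply: (big_ind chain) => //; first exact: (chainC 0).
move=> m _; rewrite -mul_mpolyC; apply: (chainM _ _) => //.
rewrite mpolyXE_id; apply: (big_ind chain) => //; first exact: (chainC 1).
move=> i _; elim: (m i) => [|j IHj]; first by rewrite expr0; exact: (chainC 1).
by rewrite exprS; exact: (chainM _ _ _ _).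
Qed.

End Composition.

Lemma msize_mderiv_lt (K : fieldType) n (p : {mpoly K[n]}) i :
  p != 0 -> (msize p^`M(i) < msize p)%N.
Proof.
move=> p0; rewrite [X in (X < _)%N]msizeE big_seq.
have : (0 < msize p)%N by rewrite lt0n msize_poly_eq0.
elim/big_ind: _ => [//|u v Hu Hv sz|m mp _]; first by rewrite gtn_max Hu ?Hv.
have : (m + U_(i))%MM \in msupp p.
  move: mp; rewrite !mcoeff_msupp mcoeff_deriv; apply: contraNneq => ->.
  by rewrite mul0rn.
by move/msize_mdeg_lt; rewrite mdegD mdeg1 addn1.
Qed.

Lemma msize_mderiv (K : fieldType) n (p : {mpoly K[n]}) i :
  (msize p^`M(i) <= degree p)%N.
Proof.
have [->|/(msize_mderiv_lt i)] := eqVneq p 0; first by rewrite mderiv0 msize0.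
by rewrite /degree; case: (msize p).
Qed.

Lemma msize_mul_le (K : fieldType) n (p q : {mpoly K[n]}) a b :
  (msize p <= a.+1 -> msize q <= b.+1 -> msize (p * q) <= (a + b).+1)%N.
Proof.
have [->|p0] := eqVneq p 0; first by rewrite mul0r msize0.
have [->|q0] := eqVneq q 0; first by rewrite mulr0 msize0.
rewrite msizeM // => pa qb; rewrite -subn1 leq_subLR add1n -addSn -addnS.
exact: leq_add.
Qed.

Section AlgebraicDependence.
Variables (K : fieldType) (n M : nat) (h : M.-tuple {mpoly K[n]}).

(** Counting dimensions: the products of powers of h_i with exponents at
most N number (N + 1)^M, and their monomials have exponents below (M D +
1)(N + 1) with D independent of N, which leaves room for a power n only.
For N large the products are linearly dependent. *)
Lemma exists_algebraic_relation : (n < M)%N ->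
  exists2 P : {mpoly K[M]}, P != 0 & P \mPo h = 0.
Proof.
move=> ltnM; pose D := (\max_(i < M) msize (tnth h i))%N.
(* The number of target monomials is at most (c (N + 1))^n, and c^n < N +
   1. *)
pose c := (M * D).+1; pose N := (c ^ n)%N; pose B := (M * (N * D)).+1.
pose E := {ffun 'I_M -> 'I_N.+1}; pose E' := {ffun 'I_n -> 'I_B}.
pose mon (e : E) : 'X_{1..M} := [multinom (e i : nat) | i < M].
pose mon' (e : E') : 'X_{1..n} := [multinom (e i : nat) | i < n].
have ltE : (#|E'| < #|E|)%N.
  rewrite !card_ffun !card_ord; apply: (@leq_ltn_trans (N.+1 ^ n * c ^ n)).
    have BNc : (B <= N.+1 * c)%N by rewrite /B /c; nia.
    by rewrite -expnMn; case: (n) => [|n']; rewrite ?expn0 ?leq_exp2r.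
  apply: (@leq_trans (N.+1 ^ n.+1)); last exact: leq_pexp2l.
  by rewrite expnSr ltn_pmul2l // expn_gt0.
pose A : 'M[K]_(#|E|, #|E'|) :=
  \matrix_(i, j) ('X_[mon (enum_val i)] \mPo h)@_(mon' (enum_val j)).
have : kermx A != 0.
  rewrite -mxrank_eq0 mxrank_ker subn_eq0 -ltnNge.
  exact: leq_ltn_trans (rank_leq_col A) ltE.
case/rowV0Pn => u /sub_kermxP uA u0.
exists (\sum_i u 0 i *: 'X_[mon (enum_val i)]).
  have /rV0Pn[i ui] := u0; apply: contraNneq ui =>
    /(congr1 (mcoeff (mon (enum_val i)))).
  rewrite mcoeff0 raddf_sum (bigD1 i) //= big1 ?addr0 => [|j ji].
    by rewrite mcoeffZ mcoeffX eqxx mulr1 => ->.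
  rewrite mcoeffZ mcoeffX; case: eqP => [/mnmP e|_]; last by rewrite mulr0.
  case/eqP: ji; apply: enum_val_inj; apply/ffunP => k.
  by apply: val_inj; have := e k; rewrite !mnmE.
apply/mpolyP => m; rewrite mcoeff0 (raddf_sum (comp_mpoly h))
  (raddf_sum (mcoeff m)) /=.
have [mB|/forallPn[k]] := boolP [forall k, m k < B]%N; last first.
  rewrite -leqNgt => Bm; apply: big1 => i _.
  rewrite comp_mpolyZ mcoeffZ comp_mpolyX; apply/eqP; rewrite mulf_eq0;
    apply/orP; right.
  rewrite mcoeff_eq0; apply: msize_mdeg_ge.
  apply: leq_trans (leq_trans Bm _); last first.
    by rewrite mdegE (bigD1 k) //= leq_addr.
  have : ((\sum_(l < M) mon (enum_val i) l * D)%N < B)%N.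
    rewrite ltnS -[M in leqRHS]card_ord -sum_nat_const; apply: leq_sum => l _.
    by rewrite mnmE leq_mul2r -ltnS ltn_ord orbT.
  apply: leq_trans; elim/big_rec2: _ => [|l k' p _ IHp];
    first by rewrite msize1.
  apply: msize_mul_le IHp; elim: (mon _ l) => [|j IHj]; first by rewrite msize1.
  rewrite exprS mulSn; apply: msize_mul_le IHj.
  exact: leq_trans (leq_bigmax l) (leqnSn _).
pose e : E' := [ffun k => Ordinal (forallP mB k)].
have -> : m = mon' e by apply/mnmP => k; rewrite !mnmE ffunE.
have := congr1 (fun w : 'rV_#|E'| => w 0 (enum_rank e)) uA.
rewrite !mxE => {2}<-; apply: eq_bigr => i _.
by rewrite comp_mpolyZ mcoeffZ mxE enum_rankK.
Qed.

End AlgebraicDependence.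

(** * The Jacobian criterion *)

Definition jacobian (K : fieldType) n q (h : q.-tuple {mpoly K[n]}) :
  'M[{mpoly K[n]}]_(q, n) := \matrix_(i, j) (tnth h i)^`M(j).

Definition jacobian_at (K : fieldType) n q (h : q.-tuple {mpoly K[n]})
  (x : 'I_n -> K) : 'M[K]_(q, n) := map_mx (meval x) (jacobian h).

(** A map g that is not injective gives the determinant 0, so arbitrary maps
index the minors as well as sets of rows do. *)
Lemma row_full_minor (K : fieldType) m n (A : 'M[K]_(m, n)) :
  row_full A <-> exists g : 'I_n -> 'I_m, \det (rowsub g A) != 0.
Proof.
split=> [fA|[g]]; last first.
  rewrite -unitfE -unitmxE -row_full_unit -sub1mx => fg.
  rewrite -sub1mx; apply: submx_trans fg _; exact: rowsub_sub.
exists (fullrankfun fA).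
by have := fullrowsub_unit fA; rewrite unitmxE unitfE.
Qed.

Section JacobianCriterion.
Variables (K : numFieldType) (n q : nat) (f : q.-tuple {mpoly K[n]}).

(** Differentiating a relation P(h) = 0 gives a linear relation among the
dh_l. *)
Lemma comp_jacobian_row M (P : {mpoly K[M]}) (h : M.-tuple {mpoly K[n]}) x :
  P \mPo h = 0 ->
  (\row_l (P^`M(l) \mPo h).@[x]) *m jacobian_at h x = 0.
Proof.
move=> Ph0; apply/rowP => k; rewrite !mxE.
have := congr1 (fun p => (mderiv k p).@[x]) Ph0.
rewrite mderiv0 meval0 mderiv_comp rmorph_sum /= => E.
apply: etrans E; apply: eq_bigr => l _.
by rewrite !mxE mevalM.
Qed.

(** Suppose the rank s of the Jacobian is less than q everywhere; let it be
attained at a, and complete the row space at a by n - s linear forms.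
The q + n - s > n polynomials so obtained satisfy a relation P; take it
of minimal degree. At a generic point the linear forms stay independent
of the df_i, so the derivatives of P with respect to their variables
vanish at the polynomials, and by minimality these derivatives are 0. In
characteristic 0 the relation then involves the f_i only. *)
Theorem jacobian_criterion : alg_independent f ->
  exists x, row_free (jacobian_at f x).
Proof.
move=> fI; apply: contrapT => /forallNP nofree.
have [a aMax] : exists a, forall x,
  (\rank (jacobian_at f x) <= \rank (jacobian_at f a))%N.
  have exP : exists k, `[< exists x, \rank (jacobian_at f x) = k >].
    by exists (\rank (jacobian_at f (fun _ => 0))); apply/asboolP; eexists.
  have bdP k : `[< exists x, \rank (jacobian_at f x) = k >] -> (k <= n)%N.
    by move=> /asboolP[x <-]; exact: rank_leq_col.
  case: (ex_maxnP exP bdP) => k /asboolP[a <-] kmax; exists a => x.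
  by apply: kmax; apply/asboolP; exists x.
have {}nofree : (\rank (jacobian_at f a) < q)%N.
  by rewrite ltn_neqAle rank_leq_row andbT; apply/negP/nofree.
pose C := row_base (jacobian_at f a)^C%MS;
  pose r := \rank (jacobian_at f a)^C%MS.
have rE : (\rank (jacobian_at f a) + r = n)%N.
  by rewrite /r mxrank_compl subnKC // rank_leq_col.
pose ell : r.-tuple {mpoly K[n]} := [tuple \sum_j C t j *: 'X_j | t < r].
pose h : (q + r).-tuple {mpoly K[n]} := [tuple of f ++ ell].
have hl i : tnth h (lshift r i) = tnth f i by rewrite tnth_lshift.
have hr t : tnth h (rshift q t) = tnth ell t by rewrite tnth_rshift.
have Jh x : jacobian_at h x = col_mx (jacobian_at f x) C.
  rewrite -[LHS]vsubmxK; congr col_mx; apply/matrixP => i j; rewrite 3!mxE.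
    by rewrite hl !mxE.
  rewrite hr tnth_mktuple (raddf_sum (mderiv j)) (raddf_sum (meval x))
    (bigD1 j) //=.
  rewrite big1 => [|k kj].
    by rewrite mderivZ mderivX mnm1E eqxx -{1}[U_(j)%MM]add0m addmK mpolyX0
      scale1r mevalZ meval1 mulr1 addr0.
  by rewrite mderivZ mderivX mnm1E (negPf kj) scale0r scaler0 meval0.
have [|P0 P0N0 P0h] := exists_algebraic_relation h.
  by rewrite -{1}rE ltn_add2r.
pose rel k := `[< exists P : {mpoly K[q + r]},
  [/\ P != 0, P \mPo h = 0 & msize P = k] >].
have exR : exists k, rel k by exists (msize P0); apply/asboolP; exists P0.
case: (ex_minnP exR) => k /asboolP[P [PN0 Ph0 Pk]] Pmin.
have fullA : row_full (jacobian_at h a).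
  rewrite Jh -sub1mx -addsmxE.
  apply: submx_trans (addsmxS (submx_refl _) _); last by rewrite eq_row_base.
  by rewrite sub1mx addsmx_compl_full.
have /row_full_minor[g gP] := fullA.
pose mu := \det (rowsub g (jacobian h)).
have muE x : mu.@[x] = \det (rowsub g (jacobian_at h x)).
  by rewrite -det_map_mx map_mxsub.
have Pt t : P^`M(rshift q t) = 0.
  have : mu * (P^`M(rshift q t) \mPo h) = 0.
    apply: mpoly_eq0_meval => x; rewrite mevalM muE.
    have [->|gx] := eqVneq (\det (rowsub g (jacobian_at h x))) 0;
      first by rewrite mul0r.
    have fullx : row_full (jacobian_at h x) by apply/row_full_minor; exists g.
    have := comp_jacobian_row x Ph0; set w := \row_l _ => wJ.
    suff : rsubmx w = 0.
      by move/rowP/(_ t); rewrite !mxE => ->; rewrite mulr0.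
    move: wJ; rewrite Jh -[w in w *m _]hsubmxK mul_row_col => /eqP.
    rewrite addr_eq0 => /eqP wE.
    (* The ranks of the two families add up to at most n, and they span. *)
    have cap0 : (jacobian_at f x :&: C)%MS = 0.
      apply/eqP; rewrite -mxrank_eq0 -leqn0
        -(leq_add2l (\rank (jacobian_at f x + C)%MS)).
      rewrite mxrank_sum_cap addn0 addsmxE -Jh (eqP fullx) -[leqRHS]rE.
      by rewrite leq_add // eq_row_base.
    have : (rsubmx w *m C <= jacobian_at f x :&: C)%MS.
      by rewrite sub_capmx submxMl andbT -eqmx_opp -wE submxMl.
    rewrite cap0 submx0 => /eqP wC.
    by apply: (row_free_inj (row_base_free _)); rewrite wC mul0mx.
  move/eqP; rewrite mulf_eq0 => /orP[/eqP mu0|/eqP Pth].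
    by move: gP; rewrite -muE mu0 meval0 eqxx.
  apply: contrapT => /eqP Pt0; have := msize_mderiv_lt (rshift q t) PN0.
  rewrite Pk ltnNge; case/negP; apply: Pmin; apply/asboolP.
  by eexists; split; [exact: Pt0| exact: Pth|].
(* In characteristic 0 a polynomial with zero derivative does not contain
   the variable. *)
have Pr m t : m \in msupp P -> m (rshift q t) = 0%N.
  move=> mP; apply: contrapT => /eqP mt.
  have := congr1 (mcoeff (m - U_(rshift q t))) (Pt t).
  rewrite mcoeff_deriv submK ?lep1mP // mcoeff0 => /eqP.
  rewrite mulrn_eq0 /= => /eqP Pm.
  by move: mP; rewrite mcoeff_msupp Pm eqxx.
pose cut d (s : q.-tuple {mpoly K[d]}) : (q + r).-tuple {mpoly K[d]} :=
  [tuple match split i with inl j => tnth s j | inr _ => 0 end | i < q + r].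
have cutE d (s : q.-tuple {mpoly K[d]}) (H : (q + r).-tuple {mpoly K[d]}) :
    (forall i, tnth H (lshift r i) = tnth s i) -> P \mPo H = P \mPo cut d s.
  move=> Hs; apply: eq_comp_mpoly_msupp => m i mP.
  rewrite tnth_mktuple; case: split_ordP => j -> //.
  by rewrite Pr.
pose Q := P \mPo cut q [tuple 'X_i | i < q].
have QE d (s : q.-tuple {mpoly K[d]}) : Q \mPo s = P \mPo cut d s.
  rewrite comp_mpoly_comp; congr (P \mPo _); apply: eq_from_tnth => i.
  rewrite !tnth_mktuple; case: split => j; last by rewrite comp_mpoly0.
  by rewrite tnth_mktuple comp_mpoly_tnth.
have Q0 : Q = 0 by apply: fI; rewrite QE -(cutE _ f h).
move/eqP: PN0; apply; rewrite -[P]comp_mpoly_id.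
rewrite (cutE _ [tuple 'X_(lshift r i) | i < q]) => [|i].
  by rewrite -QE Q0 comp_mpoly0.
by rewrite !tnth_mktuple.
Qed.

End JacobianCriterion.

(** * Minors *)

(** Minors with arbitrary index maps are compared with those with increasing
maps, which differ by a sign or are zero. *)
Lemma injective_sort r n (I : 'I_r -> 'I_n) : injective I ->
  exists s : 'S_r, {homo (I \o s) : i j / (i < j)%N}.
Proof.
move=> Iinj; pose leO := fun a b : 'I_n => (a <= b)%N.
have leO_trans : transitive leO by move=> a b c; exact: leq_trans.
have leO_total : total leO by move=> a b; exact: leq_total.
pose t := [tuple I i | i < r]; pose u := [tuple of sort leO t].
have /tuple_permP[s uE] : perm_eq u t by rewrite perm_sort.
exists s => i j ij.
have usrt : sorted leO u by apply: sort_sorted.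
have uI (k : 'I_r) : nth (I i) u k = I (s k).
  by rewrite uE -tnth_nth !tnth_mktuple.
have lt_size (k : 'I_r) : (k : nat) \in [pred l | (l < size u)%N].
  by rewrite inE size_tuple ltn_ord.
have := sorted_ltn_nth leO_trans (I i) usrt _ _ (lt_size i) (lt_size j) ij.
rewrite !uI /leO leq_eqVlt => /predU1P[|//] /val_inj/Iinj/perm_inj e.
by rewrite e ltnn in ij.
Qed.

Lemma det_row_perm (A : comNzRingType) r (M : 'M[A]_r) (s : 'S_r) :
  \det (row_perm s M) = (-1) ^+ s * \det M.
Proof. by rewrite row_permE det_mulmx det_perm. Qed.

Lemma minor_sort_rows (A : comNzRingType) n m r (M : 'M[A]_(n, m))
    (I : 'I_r -> 'I_n) (J : 'I_r -> 'I_m) (s : 'S_r) :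
  \det (mxsub (I \o s) J M) = (-1) ^+ s * \det (mxsub I J M).
Proof. by rewrite -det_row_perm; congr (\det _); apply/matrixP => i j;
  rewrite !mxE. Qed.

Lemma minor_sort_cols (A : comNzRingType) n m r (M : 'M[A]_(n, m))
    (I : 'I_r -> 'I_n) (J : 'I_r -> 'I_m) (s : 'S_r) :
  \det (mxsub I (J \o s) M) = (-1) ^+ s * \det (mxsub I J M).
Proof.
rewrite -det_tr -[in RHS]det_tr -det_row_perm; congr (\det _).
by apply/matrixP => i j; rewrite !mxE.
Qed.

Lemma minor_noninjective (A : comNzRingType) n m r (M : 'M[A]_(n, m))
    (I : 'I_r -> 'I_n) (J : 'I_r -> 'I_m) : ~ injective I ->
      \det (mxsub I J M) = 0.
Proof.
move=> /injectiveP/injectivePn[i [j ij Iij]].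
by apply: (determinant_alternate ij) => k; rewrite !mxE Iij.
Qed.

Lemma divides_all_minors (A : idomainType) (d : A) n m r (M : 'M[A]_(n, m))
    (J : 'I_r -> 'I_m) :
  (forall I : 'I_r -> 'I_n, {homo I : i j / (i < j)%N} ->
    divides d (\det (mxsub I J M))) ->
  forall I : 'I_r -> 'I_n, divides d (\det (mxsub I J M)).
Proof.
move=> dM I; have [/injective_sort[s Is]|/minor_noninjective ->] := pselect
  (injective I).
  have -> : \det (mxsub I J M) = (-1) ^+ s * \det (mxsub (I \o s) J M).
    by rewrite minor_sort_rows signrMK.
  by apply: divides_mull; apply: dM.
exact: divides0.
Qed.

Lemma exists_sorted_minor (K : fieldType) n m (M : 'M[K]_(n, m)) :
  exists (I : 'I_(\rank M) -> 'I_n) (J : 'I_(\rank M) -> 'I_m),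
    [/\ {homo I : i j / (i < j)%N}, {homo J : i j / (i < j)%N}
      & \det (mxsub I J M) != 0].
Proof.
have [g gM] : exists g : 'I_(\rank M) -> 'I_m,
    \det (mxsub (maxrankfun M) g M) != 0.
  have /row_full_minor[g gM] : row_full (rowsub (maxrankfun M) M)^T.
    by rewrite /row_full mxrank_tr; exact: maxrowsub_free.
  exists g; rewrite -det_tr; congr (\det _ != 0): gM.
  by apply/matrixP => i j; rewrite !mxE.
have [s sI] := injective_sort (@maxrankfun_inj _ _ _ M).
have ginj : injective g.
  apply: contrapT => Ng; case/eqP: gM; rewrite -det_tr.
  have -> : (mxsub (maxrankfun M) g M)^T = mxsub g (maxrankfun M) M^T.
    by apply/matrixP => i j; rewrite !mxE.
  exact: minor_noninjective.
have [t tJ] := injective_sort ginj.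
exists (maxrankfun M \o s), (g \o t); split=> //.
by rewrite minor_sort_rows minor_sort_cols !mulf_eq0 !signr_eq0.
Qed.

(** The product of the stacked matrices is block triangular. *)
Lemma complementary_minors (A : comNzRingType) q r (X : 'M[A]_(q, q + r))
    (Z : 'M[A]_(r, q + r)) (P : 'M[A]_(q + r, q)) (Y : 'M[A]_(q + r, r)) :
  X *m Y = 0 ->
  \det (X *m P) * \det (Z *m Y) = \det (col_mx X Z) * \det (row_mx P Y).
Proof. by move=> XY; rewrite -det_mulmx mul_col_row XY det_lblock. Qed.

(** Laplace expansion along the columns of P, one at a time. *)
Lemma divides_det_row_mx (A : idomainType) (d : A) q r (P : 'M[A]_(q + r, q))
    (Y : 'M[A]_(q + r, r)) :
  (forall I : 'I_r -> 'I_(q + r), divides d (\det (rowsub I Y))) ->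
  divides d (\det (row_mx P Y)).
Proof.
elim: q P Y => [|q IHq] P Y dY.
  have -> : row_mx P Y = rowsub id Y; last exact: dY.
  apply/matrixP => i j; rewrite [RHS]mxE -(row_mxEr P Y).
  by congr (row_mx _ _ _ _); apply: val_inj.
rewrite (expand_det_col _ (lshift r ord0)).
elim/big_ind: _ => [|a b|i _]; [exact: divides0|exact: divides_add|].
apply: divides_mull; apply: divides_mull.
rewrite col'Kl.
have -> : row' i (row_mx (col' ord0 P) Y) = row_mx (row' i (col' ord0 P))
  (row' i Y).
  by apply/matrixP => j k; rewrite !mxE; case: split => l; rewrite !mxE.
apply: IHq => I.
have -> : rowsub I (row' i Y) = rowsub (lift i \o I) Y; last exact: dY.
by apply/matrixP => j k; rewrite !mxE.
Qed.

(** Let w be the determinant in the conclusion. For every choice c of q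
columns, complementary_minors gives det (colsub c X) * d * h = w * det
(row_mx P Y), where P selects the rows in c and the last determinant is
divisible by d. So w divides det (colsub c X) * h for all c, and the
first factors have no common prime. *)
Theorem annihilated_minor_divisible (A : idomainType) n q r (X : 'M[A]_(q, n))
    (Y : 'M[A]_(n, r)) (d h : A) (I : 'I_r -> 'I_n) (nE : n = (q + r)%N) :
  factorial_domain A -> X *m Y = 0 -> d != 0 ->
  (exists c : 'I_q -> 'I_n, \det (colsub c X) != 0) ->
  (forall p, prime_element p -> ~ forall c : 'I_q ->
    'I_n, divides p (\det (colsub c X))) ->
  (forall I' : 'I_r -> 'I_n, divides d (\det (rowsub I' Y))) ->
  d * h = \det (rowsub I Y) ->
  divides (\det (castmx (esym nE, erefl n) (col_mx X (rowsub I 1%:M)))) h.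
Proof.
subst n => fA XY d0 [c0 c0X] copX dY hE; rewrite castmx_id; set w := \det _.
have key c : divides w (\det (colsub c X) * h).
  have := complementary_minors (rowsub I 1%:M) (colsub c 1%:M) XY.
  rewrite mulmx_colsub mulmx1 mul_rowsub_mx mul1mx -hE -/w.
  have [k ->] := divides_det_row_mx (colsub c 1%:M) dY.
  rewrite mulrCA [w * _]mulrCA => /(mulfI d0) ->; exact:
    divides_mulr (divides_refl _).
have [w0|wN0] := eqVneq w 0.
  have [k] := key c0; rewrite w0 mul0r => /eqP.
  by rewrite mulf_eq0 (negPf c0X) /= => /eqP ->; exact: divides0.
apply: (@coprime_cancel _ [set t | exists c, t = \det (colsub c X)]) => //.
  by move=> p pp pX; apply: (copX p pp) => c; apply: pX; exists c.
by move=> t [c ->].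
Qed.

(** Vanishing of the determinant in annihilated_minor_divisible at the
points of the dependent locus. *)
Lemma det_stack_dependent (K : fieldType) n q r (nE : n = (q + r)%N)
    (X : 'M[K]_(q, n)) (Z : 'M[K]_(r, n)) :
  ~~ row_free X -> \det (castmx (esym nE, erefl n) (col_mx X Z)) = 0.
Proof.
subst n; rewrite castmx_id -kermx_eq0 => /rowV0Pn[z /sub_kermxP zX z0].
apply/eqP/det0P; exists (row_mx z 0);
  last by rewrite mul_row_col zX mul0mx addr0.
by apply: contraNneq z0 => /(congr1 lsubmx); rewrite row_mxKl linear0 => ->.
Qed.

(** * The left kernel of a Jordan-Kronecker pencil *)

Section PencilKernel.
Variable F : fieldType.

(** Jordan blocks of both kinds and horizontal blocks all have this shape
away from the eigenvalue of the block, with c the entry on the diagonal. *)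
Lemma bidiagonal_left_kernel p p' (M : 'M[F]_(p, p')) (c d : F) (u : 'rV_p) :
  (p <= p')%N -> c != 0 ->
  (forall i j, M i j = c * (j == i :> nat)%:R + d * (j == i.+1 :> nat)%:R) ->
  u *m M = 0 -> u = 0.
Proof.
move=> lepp' c0 ME uM; apply/rowP => j; rewrite mxE.
case: j => j; elim/ltn_ind: j => j IHj ltjp.
have := congr1 (fun v : 'rV_p' => v 0 (Ordinal (leq_trans ltjp lepp'))) uM.
rewrite !mxE (bigD1 (Ordinal ltjp)) //= big1 => [|i ij]; last first.
  rewrite ME /=; have [ltij|ltji|eij] := ltngtP i j.
  - by case: i ij ltij => i ltip /= _ ltij; rewrite (IHj i ltij ltip) mul0r.
  - by rewrite (ltn_eqF (leqW ltji)) !mulr0 addr0 mulr0.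
  - by case/eqP: ij; apply: val_inj.
rewrite ME /= eqxx (ltn_eqF (ltnSn j)) mulr0 addr0 mulr1 addr0 => /eqP.
by rewrite mulf_eq0 (negPf c0) orbF => /eqP.
Qed.

Lemma vertical_left_kernel k (M : 'M[F]_(k.+1, k)) (c : F) (u : 'rV_k.+1) :
  (forall i j, M i j = (i == j.+1 :> nat)%:R - c * (i == j :> nat)%:R) ->
  u *m M = 0 -> forall i, u 0 i = c ^+ i * u 0 ord0.
Proof.
move=> ME uM [i ltik]; elim: i ltik => [|i IHi] ltik.
  by rewrite mul1r; congr (u _ _); apply: val_inj.
have ltik' : (i < k)%N by [].
have := congr1 (fun v : 'rV_k => v 0 (Ordinal ltik')) uM; rewrite !mxE.
rewrite (bigD1 (Ordinal (ltnW ltik))) //= (bigD1 (Ordinal ltik)) /=; last first.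
  by rewrite -val_eqE /= neq_ltn ltnSn orbT.
rewrite big1 => [|l /andP[l1 l2]]; last first.
  rewrite ME -!val_eqE /= in l1 l2 *.
  by rewrite (negPf l1) (negPf l2) mulr0 subr0 mulr0.
rewrite addr0 !ME /= eqxx (ltn_eqF (ltnSn i)) (gtn_eqF (ltnSn i)) eqxx.
rewrite mulr0 subr0 mulr1 sub0r mulr1 addrC mulrN => /eqP.
by rewrite subr_eq0 => /eqP ->; rewrite IHi exprS mulrC mulrA.
Qed.

(** The values of t at which the left kernel of the block need not be zero,
or at which it is not read off from a nonzero diagonal. *)
Definition block_bad (b : jk_block F) : seq F :=
  match b with Jordan a _ => [:: a] | Horizontal _ => [:: 0] | _ => [::] end.

Definition is_vertical (b : jk_block F) : bool :=
  if b is Vertical _ then true else false.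

(** For a vertical block the identity says that u is proportional to (1, t,
..., t^k); the symmetric form treats all entries alike. *)
Lemma block_left_kernel b t (u : 'rV_(block_rows b)) :
  t \notin block_bad b -> u *m (blockA b + t *: blockB b) = 0 ->
  if is_vertical b then forall i j :
    'I_(block_rows b), t ^+ i * u 0 j = t ^+ j * u 0 i
  else u = 0.
Proof.
case: b u => [a k|k|k|k] /= u tb uM.
- apply: (bidiagonal_left_kernel (c := a - t) (d := 1) _ _ _ uM) => // [|i j].
    by rewrite subr_eq0 eq_sym; rewrite inE in tb.
  by rewrite !mxE -[a *+ _]mulr_natr mulrN mul1r mulrBl addrAC.
- apply: (bidiagonal_left_kernel (c := 1) (d := - t) _ _ _ uM) => // [|i j].
    exact: oner_neq0.
  by rewrite !mxE mul1r mulrN mulNr.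
- apply: (bidiagonal_left_kernel (c := - t) (d := 1) _ _ _ uM) => // [|i j].
    by rewrite oppr_eq0; rewrite inE in tb.
  by rewrite !mxE mul1r mulrN mulNr addrC.
- have uE : forall i, u 0 i = t ^+ i * u 0 ord0.
    apply: vertical_left_kernel uM => i j; rewrite !mxE mulrN.
    by rewrite [(j : nat) == i]eq_sym.
  by move=> i j; rewrite (uE j) (uE i) mulrCA.
Qed.

(** The map pos describes the rows of the pencil: it sends a row to (j, s)
if it is row s of the j-th vertical block, and to None if it is not in a
vertical block. *)
Lemma pencil_left_kernel (bs : seq (jk_block F)) :
  exists (pos : 'I_(jk_rows bs) -> option (nat * nat)) (bad : seq F),
  [/\ forall j s, (s < nth 0 (vertical_heights bs) j)%N ->
    exists i, pos i = Some (j, s),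
      forall i j s, pos i = Some (j, s) -> (s < nth 0 (vertical_heights bs) j)%N
    & forall t, t \notin bad -> forall u :
      'rV_(jk_rows bs), u *m jk_mx t bs = 0 ->
      (forall i, pos i = None -> u 0 i = 0) /\
      (forall i i' j s s', pos i = Some (j, s) -> pos i' = Some (j, s') ->
         t ^+ s * u 0 i' = t ^+ s' * u 0 i)].
Proof.
elim: bs => [|b bs [pos [bad [posE posB posK]]]].
  exists (fun _ => None), [::]; split=> // [j s|t _ u _].
    by rewrite nth_nil.
  by split=> // -[].
pose v := is_vertical b.
pose pos' (i : 'I_(jk_rows (b :: bs))) : option (nat * nat) :=
  match split (i : 'I_(block_rows b + jk_rows bs)) with
  | inl i => if v then Some (0%N, i : nat) else None
  | inr i => if pos i is Some (j, s) then Some ((v + j)%N, s) else None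
  end.
have posl (i : 'I_(block_rows b)) :
  pos' (lshift (jk_rows bs) i) = if v then Some (0%N, i : nat) else None.
  by rewrite /pos' (unsplitK (inl i)).
have posr (i : 'I_(jk_rows bs)) :
  pos' (rshift (block_rows b) i) = if pos i is Some (j, s) then Some
    ((v + j)%N, s) else None.
  by rewrite /pos' (unsplitK (inr i)).
have nthv j : nth 0%N (vertical_heights (b :: bs)) (v + j) = nth 0%N
  (vertical_heights bs) j.
  by rewrite /v; case: (b).
have nth0 : v -> nth 0%N (vertical_heights (b :: bs)) 0 = block_rows b.
  by rewrite /v; case: (b).
exists pos', (block_bad b ++ bad); split.
- move=> j s; have [vT|vF] := boolP v; first case: j => [|j].
  + rewrite nth0 // => sb; exists (lshift (jk_rows bs) (Ordinal sb)).
    by rewrite posl vT.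
  + have := nthv j; rewrite vT => -> /posE[i ip].
    by exists (rshift (block_rows b) i); rewrite posr ip vT.
  + have := nthv j; rewrite (negPf vF) => -> /posE[i ip].
    by exists (rshift (block_rows b) i); rewrite posr ip (negPf vF).
- move=> i j s; case: (split_ordP (i : 'I_(block_rows b + jk_rows bs))) => k ->.
    by rewrite posl; case: ifP => // vT [<- <-]; rewrite nth0.
  by rewrite posr; case E: (pos k) => [[j' s']|//] [<- <-]; rewrite nthv; exact:
    posB E.
move=> t; rewrite mem_cat negb_or => /andP[tb tbad] u.
rewrite -[u](@hsubmxK _ _ (block_rows b) (jk_rows bs)) /= mul_row_block.
rewrite !mulmx0 addr0 add0r -[RHS](@row_mx0 _ _ (block_cols b) (jk_cols bs)).
move/eq_row_mx => [ul ur].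
have bl := block_left_kernel tb ul; have [br0 brK] := posK t tbad _ ur.
rewrite -/v in bl; set L := lsubmx _ in bl ul *;
  set R := rsubmx _ in ur br0 brK *.
split=> [i|i i' j s s'].
  case: (split_ordP (i : 'I_(block_rows b + jk_rows bs))) => k ->.
    by rewrite posl row_mxEl; case: ifP bl => // _ ->; rewrite mxE.
  by rewrite posr row_mxEr; case E: (pos k) => [[]|] // _; apply: br0.
case: (split_ordP (i : 'I_(block_rows b + jk_rows bs))) => k ->;
case: (split_ordP (i' : 'I_(block_rows b + jk_rows bs))) => k' ->;
rewrite ?posl ?posr ?row_mxEl ?row_mxEr.
- by case: ifP bl => // _ bl [_ <-] [_ <-]; apply: bl.
- by case: ifP => // vT [<- _]; case: (pos k') => [[j' s'']|] //; rewrite vT.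
- case: ifP => // vT.
  by case: (pos k) => [[j' s'']|] // [<- _].
- case E: (pos k) => [[j1 s1]|] // [<- <-].
  case E': (pos k') => [[j2 s2]|] // [/addnI j12 <-].
  by apply: (brK _ _ _ _ _ E); rewrite E' j12.
Qed.

End PencilKernel.

(** * Polynomial covectors killed by a pencil *)

(** Multiply the difference by the product of the t - a for a in bad: it
vanishes everywhere. *)
Lemma poly_eq_cofinite (K : numDomainType) (p p' : {poly K}) (bad : seq K) :
  (forall t, t \notin bad -> p.[t] = p'.[t]) -> p = p'.
Proof.
move=> pp'; apply/eqP; rewrite -subr_eq0.
have: (p - p') * \prod_(a <- bad) ('X - a%:P) == 0.
  apply/negPn/negP => /poly_nonroot[t].
  rewrite hornerM; have [/pp' e|tb] := boolP (t \notin bad).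
    by rewrite hornerD hornerN e subrr mul0r eqxx.
  by rewrite horner_prod (big_rem t) ?mulf_eq0 //= ?hornerXsubC ?subrr ?eqxx
    ?orbT // -[_ \in _]negbK.
by rewrite mulf_eq0 (negPf (monic_neq0 (monic_prod_XsubC _ _ _))) orbF.
Qed.

Lemma vertical_heights_gt0 (E : Type) (bs : seq (jk_block E)) j :
  (j < size (vertical_heights bs))%N -> (0 < nth 0 (vertical_heights bs) j)%N.
Proof.
elim: bs j => [|b bs IHbs] j //; rewrite /vertical_heights /=.
by case: b => [a k|k|k|k] /=; try exact: IHbs; case: j => [|j] //=; exact: IHbs.
Qed.

Lemma sum_succ q (F : 'I_q -> nat) : (\sum_i (F i).+1 = \sum_i F i + q)%N.
Proof.
by under eq_bigr do rewrite -addn1; rewrite big_split /= sum1_card card_ord.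
Qed.

Section PolynomialKernel.
Variables (K : numClosedFieldType) (bs : seq (jk_block K)) (q : nat).
Hypothesis size_bs : size (vertical_heights bs) = q.

Local Notation N := (jk_rows bs).
Local Notation h j := (nth 0%N (vertical_heights bs) j).
Local Notation ev t := (map_mx (horner_eval t)).

Lemma row_free_factor (C : 'M[K]_q) (E : 'M[K]_(q, N)) (sel : 'I_q -> 'I_N)
  (W : 'M[K]_(q, N)) :
  W = C *m E -> colsub sel W = C -> row_free W = (\det C != 0).
Proof.
move=> WE WC; rewrite -unitfE -unitmxE -row_free_unit.
apply/idP/idP; rewrite -!row_leq_rank => le; apply: leq_trans le _.
  by rewrite WE mxrankM_maxl.
have -> : C = W *m colsub sel 1%:M by rewrite mulmx_colsub mulmx1.
exact: mxrankM_maxl.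
Qed.

(** The entries of W in the top rows of the vertical blocks form C, and each
row of W is recovered from it by the powers of t. The last clause is the
same statement at t = infinity: V is killed by the reversed pencil t A +
B, where each row is recovered from the bottom rows instead. *)
Lemma top_coefficients (W : 'M[{poly K}]_(q, N)) :
  (forall t, ev t W *m jk_mx t bs = 0) ->
  exists (C : 'M[{poly K}]_q) (bot : 'I_q -> 'I_N),
    [/\ forall t, row_free (ev t W) = ((\det C).[t] != 0),
        forall i j, W i (bot j) = 'X^((h j).-1) * C i j
      & forall V : 'M[{poly K}]_(q, N),
        (forall t, t != 0 -> ev t V *m jk_mx t^-1 bs = 0) ->
         row_free (ev 0 V) = ((\det (colsub bot V)).[0] != 0)].
Proof.
move=> WK; have [pos [bad [posE posB posK]]] := pencil_left_kernel bs.
have hgt0 (j : 'I_q) : (0 < h j)%N by apply: vertical_heights_gt0;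
  rewrite size_bs.
have /choice[top topP] (j : 'I_q) : exists i, pos i = Some (j : nat, 0%N).
  by apply: posE; apply: hgt0.
have /choice[bot botP] (j : 'I_q) : exists i, pos i = Some (j : nat, (h j).-1).
  by apply: posE; rewrite prednK.
have posq i j s : pos i = Some (j, s) -> (j < q)%N.
  move=> /posB sh; rewrite -size_bs ltnNge; apply/negP => le.
  by rewrite nth_default in sh.
have kerW i t : row i (ev t W) *m jk_mx t bs = 0 by rewrite -row_mul WK row0.
have W0 i k : pos k = None -> W i k = 0.
  move=> pk; apply: (@poly_eq_cofinite _ _ _ bad) => t tb; rewrite horner0.
  have [+ _] := posK t tb _ (kerW i t).
  by move/(_ k pk); rewrite !mxE.
have WX i k k' j s s' : pos k = Some (j, s) -> pos k' = Some (j, s') ->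
    'X^s * W i k' = 'X^s' * W i k.
  move=> pk pk'; apply: (@poly_eq_cofinite _ _ _ bad) => t tb.
  have [_] := posK t tb _ (kerW i t).
  by move/(_ _ _ _ _ _ pk pk'); rewrite !mxE !hornerM !hornerXn.
exists (colsub top W), bot; split.
- move=> t; pose E : 'M[{poly K}]_(q, N) := \matrix_(j, k)
    if pos k is Some (j', s) then if j' == j :> nat then 'X^s else 0 else 0.
  have WE : W = colsub top W *m E.
    apply/matrixP => i k; rewrite !mxE; case Ek: (pos k) => [[j s]|];
      last first.
      by rewrite W0 // big1 // => j _; rewrite !mxE Ek mulr0.
    have jq := posq _ _ _ Ek; rewrite (bigD1 (Ordinal jq)) //= big1 =>
      [|j' j'j].
      have := WX i _ _ _ _ _ (topP (Ordinal jq)) Ek; rewrite expr0 mul1r => ->.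
      by rewrite !mxE Ek eqxx addr0 mulrC.
    rewrite !mxE Ek ifN ?mulr0 //.
    by apply: contraNneq j'j => e; apply/eqP/val_inj/esym.
  rewrite (@row_free_factor (ev t (colsub top W)) (ev t E) top).
  + by rewrite det_map_mx.
  + by rewrite {1}WE map_mxM.
  + by rewrite map_mxsub.
- move=> i j; rewrite mxE; have := WX i _ _ _ _ _ (topP j) (botP j).
  by rewrite expr0 mul1r.
move=> V VK.
have kerV i t : t != 0 -> row i (ev t V) *m jk_mx t^-1 bs = 0.
  by move=> t0; rewrite -row_mul VK ?row0.
have V0 i k : pos k = None -> V i k = 0.
  move=> pk; apply: (@poly_eq_cofinite _ _ _ (0 :: [seq a^-1 | a <- bad])) => t.
  rewrite inE negb_or => /andP[t0 tb]; rewrite horner0.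
  have tb' : t^-1 \notin bad by apply: contra tb => /(map_f GRing.inv);
    rewrite invrK.
  have [+ _] := posK _ tb' _ (kerV i t t0).
  by move/(_ k pk); rewrite !mxE.
have VX i k j s : pos k = Some (j, s) -> forall jq : (j < q)%N,
    V i k = 'X^((h j).-1 - s) * V i (bot (Ordinal jq)).
  move=> pk jq; apply: (@poly_eq_cofinite _ _ _ (0 :: [seq a^-1 | a <- bad])) =>
    t.
  rewrite inE negb_or => /andP[t0 tb].
  have tb' : t^-1 \notin bad by apply: contra tb => /(map_f GRing.inv);
    rewrite invrK.
  have [_] := posK _ tb' _ (kerV i t t0).
  move/(_ _ _ _ _ _ pk (botP (Ordinal jq))); rewrite !mxE hornerM hornerXn /= =>
    E.
  have sle : (s <= (h j).-1)%N by have := posB _ _ _ pk; case: (h j).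
  have tu : t \is a GRing.unit by rewrite unitfE.
  apply: (mulfI (expf_neq0 (h j).-1 (invr_neq0 t0))); rewrite -E mulrA.
  congr (_ * _); rewrite -{1}(subnK sle) exprD mulrAC -exprMn mulVr // expr1n
    mul1r //.
pose E : 'M[{poly K}]_(q, N) := \matrix_(j, k)
    if pos k is Some (j', s) then if j' == j :> nat then 'X^((h j).-1 - s) else
      0 else 0.
have VE : V = colsub bot V *m E.
  apply/matrixP => i k; rewrite !mxE; case Ek: (pos k) => [[j s]|]; last first.
    by rewrite V0 // big1 // => j _; rewrite !mxE Ek mulr0.
  have jq := posq _ _ _ Ek; rewrite (bigD1 (Ordinal jq)) //= big1 => [|j' j'j].
    by rewrite (VX _ _ _ _ Ek jq) !mxE Ek eqxx addr0 mulrC.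
  rewrite !mxE Ek ifN ?mulr0 //.
    by apply: contraNneq j'j => e; apply/eqP/val_inj/esym.
rewrite (@row_free_factor (ev 0 (colsub bot V)) (ev 0 E) bot).
- by rewrite det_map_mx.
- by rewrite {1}VE map_mxM.
- by rewrite map_mxsub.
Qed.

(** The degree of C i j is at most d i - h j, and det C is the sum over
permutations: a nonzero term gives the inequalities, and equal sums make
det C constant. *)
Theorem pencil_degrees (W : 'M[{poly K}]_(q, N)) (d : 'I_q -> nat) :
  (forall t, ev t W *m jk_mx t bs = 0) ->
  (forall i k, (size (W i k) <= d i)%N) ->
  (exists t, row_free (ev t W)) ->
  (exists s : 'S_q, forall i, (h (s i) <= d i)%N) /\
  ((\sum_i d i = \sum_(j < q) h j)%N -> forall t, row_free (ev t W)).
Proof.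
move=> WK Wd [t0]; have [C [bot [freeE Wbot _]]] := top_coefficients WK.
have hgt0 (j : 'I_q) : (0 < h j)%N by apply: vertical_heights_gt0;
  rewrite size_bs.
rewrite freeE => C0.
have sizeC i j : C i j != 0 -> (size (C i j) + (h j).-1 <= d i)%N.
  move=> Cij; have := Wd i (bot j); rewrite Wbot size_monicM ?monicXn //.
  by rewrite size_polyXn addSn /= addnC.
have hd i j : C i j != 0 -> (h j <= d i)%N.
  move=> Cij; apply: leq_trans (sizeC i j Cij).
  rewrite -{1}(prednK (hgt0 j)) -addn1 addnC leq_add2r lt0n size_poly_eq0 //.
split.
  have : \det C != 0 by apply: contraNneq C0 => ->; rewrite horner0.
  rewrite /determinant => /eqP detC; apply: contrapT => /forallNP Ns.
  apply: detC; apply: big1 => s _; have /existsNP[i /negP] := Ns s.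
  rewrite -ltnNge => lt; rewrite (bigD1 i) //=.
  have [->|/hd] := eqVneq (C i (s i)) 0; first by rewrite mul0r mulr0.
  by rewrite leqNgt lt.
move=> sumE t; rewrite freeE.
have szC : (size (\det C) <= 1)%N.
  rewrite /determinant; apply: (leq_trans (size_sum _ _ _)).
  apply/bigmax_leqP => s _; rewrite size_Msign.
  have [/existsP[i /eqP Ci]|/existsPn Cs] := boolP [exists i, C i (s i) == 0].
    by rewrite (bigD1 i) //= Ci mul0r size_poly0.
  apply: leq_trans (size_prod_leq _ _) _.
  rewrite leq_subLR.
  have : (\sum_i (size (C i (s i)) + h (s i)) <= \sum_i (d i).+1)%N.
    apply: leq_sum => i _; have := sizeC i (s i) (Cs i).
    by rewrite -{2}(prednK (hgt0 (s i))) addnS ltnS.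
  rewrite big_split /=.
  have -> : (\sum_i h (s i) = \sum_i d i)%N.
    by rewrite sumE [RHS](reindex_inj (@perm_inj _ s)).
  rewrite sum_succ [X in (_ <= X)%N -> _]addnC leq_add2r addn1 ltnS =>
    /leq_trans; apply.
  by rewrite cardT size_enum_ord.
move: C0; rewrite (size1_polyC szC) !hornerC //.
Qed.

(** Since W never drops rank, det C is a nonzero constant c over an
algebraically closed field. The bottom minor of V is then c t^(sum d -
sum h), and it does not vanish at 0. *)
Theorem pencil_degrees_sum (W V : 'M[{poly K}]_(q, N)) (d : 'I_q -> nat) :
  (forall t, ev t W *m jk_mx t bs = 0) ->
  (forall t, row_free (ev t W)) ->
  (forall i, (0 < d i)%N) ->
  (forall t i k, t != 0 -> (V i k).[t] = t ^+ (d i).-1 * (W i k).[t^-1]) ->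
  row_free (ev 0 V) -> (\sum_i d i = \sum_(j < q) h j)%N.
Proof.
move=> WK Wfree d0 VW; have [C [bot [freeE Wbot Vbot]]] := top_coefficients WK.
have hgt0 (j : 'I_q) : (0 < h j)%N by apply: vertical_heights_gt0;
  rewrite size_bs.
rewrite Vbot => [V0|t t0]; last first.
  have -> : ev t V = diag_mx (\row_i t ^+ (d i).-1) *m ev t^-1 W.
    by apply/matrixP => i k; rewrite mul_diag_mx !mxE /horner_eval VW.
  by rewrite -mulmxA WK mulmx0.
have [c c0 CE] : exists2 c, c != 0 & \det C = c%:P.
  apply/size_poly1P; apply/negPn/negP => /closed_rootP[t].
  by rewrite /root; have := Wfree t; rewrite freeE => /negPf->.
pose a := (\sum_(j < q) (h j).-1)%N; pose b := (\sum_(i < q) (d i).-1)%N.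
(* The factors t^a come from the bottom rows, which are t^(h j - 1) times
   the top rows; the factors t^b come from homogeneity. *)
have key : 'X^a * \det (colsub bot V) = c *: 'X^b.
  apply: (@poly_eq_cofinite _ _ _ [:: 0]) => t; rewrite inE => t0.
  have tu : t \is a GRing.unit by rewrite unitfE.
  rewrite hornerM hornerZ !hornerXn.
  have -> : (\det (colsub bot V)).[t] = \det
    (ev t (colsub bot V)) by rewrite det_map_mx.
  have -> : ev t (colsub bot V) = diag_mx (\row_i t ^+ (d i).-1) *m
      (ev t^-1 C *m diag_mx (\row_j t^-1 ^+ (h j).-1)).
    apply/matrixP => i k; rewrite mul_diag_mx mul_mx_diag !mxE /horner_eval VW
      //.
    by rewrite Wbot hornerM hornerXn [in RHS](mulrC (C i k).[_]).
  have detX (e : 'I_q -> nat) (x : K) :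
      \det (diag_mx (\row_i x ^+ e i)) = x ^+ (\sum_i e i)%N.
    by rewrite det_diag -prodrXr; apply: eq_bigr => i _; rewrite mxE.
  rewrite !det_mulmx !detX det_map_mx CE /= /horner_eval hornerC -/a -/b.
  by rewrite mulrCA [c * _]mulrC [t ^+ a * _]mulrA -exprMn mulrV // expr1n mul1r
    mulrC.
have hq : (\sum_(j < q) h j = a + q)%N.
  by rewrite -sum_succ; apply: eq_bigr => j _; rewrite prednK.
have dq : (\sum_i d i = b + q)%N.
  by rewrite -sum_succ; apply: eq_bigr => j _; rewrite prednK.
rewrite hq dq; congr (_ + _)%N; apply/eqP.
have XN e : 'X^e != 0 :> {poly K} by rewrite monic_neq0 ?monicXn.
have X0 e : (0 < e)%N -> ('X^e : {poly K}).[0] = 0.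
  by move=> e0; rewrite hornerXn expr0n eqn0Ngt e0.
case: (ltngtP a b) => // lt; move: key.
- rewrite -(subnKC (ltnW lt)) exprD scalerAr => /(mulfI (XN a)).
  move=> /(congr1 (horner^~ 0)); rewrite hornerZ X0 ?subn_gt0 // mulr0 => e.
  by rewrite e eqxx in V0.
- rewrite -{1}(subnKC (ltnW lt)) exprD -mulrA -[c *: _]mulr1 -scalerAl scalerAr.
  move=> /(mulfI (XN b)) /(congr1 (horner^~ 0)).
  rewrite hornerM X0 ?subn_gt0 // mul0r hornerZ hornerC mulr1 => e.
  by rewrite -e eqxx in c0.
Qed.

End PolynomialKernel.

(** * Coordinates, homogeneity and sorted degrees *)

(** A maximal set of independent rows of coordinates gives a basis of the
image. *)
Lemma dim_limg_lfun_mx (F : fieldType) (U W : vectType F) m n (eU : m.-tuple U)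
    (eW : n.-tuple W) (phi : 'Hom(U, W)) :
  basis_of {:U} eU -> basis_of {:W} eW ->
    \rank (lfun_mx eU eW phi) = \dim (limg phi).
Proof.
move=> bU bW; rewrite -mxrank_tr; set M := trmx _.
have phiE j : phi (tnth eU j) = \sum_i M j i *: eW`_i.
  rewrite [LHS](coord_basis bW) ?memvf //.
  by apply: eq_bigr => i _; rewrite !mxE.
pose X := [tuple phi (tnth eU (maxrankfun M j)) | j < \rank M].
have XE (c : 'rV_(\rank M)) :
    \sum_j c 0 j *: X`_j = \sum_i (c *m rowsub (maxrankfun M) M) 0 i *: eW`_i.
  under eq_bigr do rewrite -tnth_nth tnth_mktuple phiE scaler_sumr.
  rewrite exchange_big; apply: eq_bigr => i _ /=.
  rewrite !mxE scaler_suml; apply: eq_bigr => j _.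
  by rewrite !mxE scalerA.
have /freeP eW_free := basis_free bW.
have Xfree : free X.
  apply/freeP => c; rewrite (_ : \sum_(i < _) _ = \sum_j (\row_l c l) 0 j *:
    X`_j); last first.
    by apply: eq_bigr => j _; rewrite mxE.
  rewrite XE => /eW_free cM j.
  have /row_free_inj/(_ (\row_l c l) 0) := maxrowsub_free M.
  rewrite mul0mx => /(_ _)/rowP/(_ j); rewrite !mxE => -> //.
  by apply/rowP => i; rewrite cM mxE.
suff -> : limg phi = <<X>>%VS by rewrite (eqnP Xfree) size_tuple.
apply/eqP; rewrite eqEsubv; apply/andP; split; last first.
  by apply/span_subvP => w /tnthP[j ->]; rewrite tnth_mktuple memv_img ?memvf.
rewrite -(span_basis bU) limg_span; apply/span_subvP =>
  w /mapP[u /tnthP[j ->] ->].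
have /submxP[c cE] : (row j M <= rowsub (maxrankfun M) M)%MS.
  by rewrite eq_maxrowsub row_sub.
rewrite phiE (_ : \sum_i _ = \sum_i (c *m rowsub (maxrankfun M) M) 0 i *:
  eW`_i); last first.
  by apply: eq_bigr => i _; rewrite -cE [in RHS]mxE.
rewrite -XE; apply: memv_suml => l _; apply: memvZ; apply: memv_span.
by rewrite mem_nth // size_tuple.
Qed.

Section Coordinates.
Variables (F : fieldType) (V : vectType F) (n : nat) (e : n.-tuple V).
Hypothesis eb : basis_of {:V} e.

Lemma coords_surj (x : 'I_n -> F) : exists w, coords e w =1 x.
Proof.
exists (\sum_i x i *: e`_i) => i.
by rewrite /coords coord_sum_free // (basis_free eb).
Qed.

Lemma coords_line a b t i : coords e
  (a + t *: b) i = coords e a i + t * coords e b i.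
Proof. by rewrite /coords linearD linearZ. Qed.

Lemma pair_coords_surj (z : 'I_(n + n) -> F) : exists a b,
  [/\ pair_coords e (a, b) =1 z, coords e a =1 (fun i => z (lshift n i))
    & coords e b =1 (fun i => z (rshift n i))].
Proof.
have [a aE] := coords_surj (fun i => z (lshift n i)).
have [b bE] := coords_surj (fun i => z (rshift n i)).
exists a, b; split=> // k; rewrite /pair_coords.
by case: split_ordP => i -> /=; rewrite ?aE ?bE.
Qed.

Lemma differentialE (f : {mpoly F[n]}) x w :
  differential e f x w = \sum_i f^`M(i).@[coords e x] * coord e i w.
Proof.
rewrite /differential sum_lfunE; apply: eq_bigr => i _.
by rewrite scale_lfunE lfunE.
Qed.

(** The values of a combination of differentials on the basis e are the
entries of the combination of rows of the Jacobian. *)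
Lemma dependent_locusE q (f : q.-tuple {mpoly F[n]}) x :
  dependent_locus e f x <-> ~~ row_free (jacobian_at f (coords e x)).
Proof.
rewrite /dependent_locus /=.
pose X := [tuple differential e (tnth f i) x | i < q].
suff -> : free X = row_free (jacobian_at f (coords e x)) by [].
have XE (c : 'rV_q) j : (\sum_i c 0 i *: X`_i) (tnth e j) =
  (c *m jacobian_at f (coords e x)) 0 j.
  rewrite sum_lfunE mxE; apply: eq_bigr => i _.
  rewrite scale_lfunE -tnth_nth tnth_mktuple differentialE !mxE
    (bigD1 j) //= big1 => [|k kj].
    by rewrite (tnth_nth 0 e) coord_free ?(basis_free eb) // eqxx mulr1 addr0.
  by rewrite (tnth_nth 0 e) coord_free ?(basis_free eb) // eq_sym
    (negPf kj) mulr0.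
apply/idP/idP => [/freeP fX|Jfree].
  rewrite -kermx_eq0; apply/eqP/row_matrixP => l; rewrite row0.
  apply/rowP => i; rewrite [RHS]mxE.
  apply: (fX (fun i => (row l (kermx (jacobian_at f (coords e x)))) 0 i)).
  apply/lfunP => w; rewrite zero_lfunE [w](coord_basis eb) ?memvf // linear_sum
    big1 // => j _.
  by rewrite linearZ /= -tnth_nth XE -row_mul mulmx_ker row0 mxE scaler0.
apply/freeP => c c0 i.
have /row_free_inj/(_ (\row_l c l) 0) := Jfree.
rewrite mul0mx => /(_ _)/rowP/(_ i); rewrite !mxE => -> //.
apply/rowP => j; rewrite -XE mxE.
rewrite (_ : \sum_i _ = 0) ?zero_lfunE // -[RHS]c0.
by apply: eq_bigr => k _; rewrite mxE.
Qed.

End Coordinates.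

Lemma vertical_heights_type (F : fieldType) (bs : seq (jk_block F)) :
  vertical_heights (map (@block_type F) bs) = vertical_heights bs.
Proof.
by elim: bs => [|b bs IHbs] //;
  rewrite /vertical_heights /= -/(vertical_heights _) IHbs; case: b.
Qed.

Lemma row_free_minor (F : fieldType) m n (A : 'M[F]_(m, n)) :
  row_free A <-> exists c : 'I_m -> 'I_n, \det (colsub c A) != 0.
Proof.
have -> : row_free A = row_full A^T by rewrite /row_full mxrank_tr.
rewrite row_full_minor; split=> -[c cA]; exists c; move: cA; rewrite -det_tr;
  by congr (\det _ != 0); apply/matrixP => i j; rewrite !mxE.
Qed.

Lemma dhomog_mderiv (F : numDomainType) n (p : {mpoly F[n]}) d i :
  p \is d.-homog -> p^`M(i) \is d.-1.-homog.
Proof.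
move=> /dhomogP hp; apply/dhomogP => m; rewrite mcoeff_msupp mcoeff_deriv => mp.
have /hp : (m + U_(i))%MM \in msupp p.
  by rewrite mcoeff_msupp; apply: contraNneq mp => ->; rewrite mul0rn.
by rewrite /= mdegD mdeg1 => <-; rewrite addn1.
Qed.

Lemma dhomog_meval (F : fieldType) n (p : {mpoly F[n]}) d t (x y : 'I_n -> F) :
  p \is d.-homog -> (forall i, x i = t * y i) -> p.@[x] = t ^+ d * p.@[y].
Proof.
move=> /dhomogP hp xy; rewrite !mevalE mulr_sumr !big_seq; apply: eq_bigr =>
  m mp.
rewrite mulrCA; congr (_ * _); rewrite -(hp m mp) /= mdegE -prodrXr -big_split.
by apply: eq_bigr => i _; rewrite xy exprMn.
Qed.

(** Among the i + 1 indices j <= i, one has s j >= i. *)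
Lemma sorted_matching q (v d : q.-tuple nat) (s : 'S_q) :
  sorted leq v -> sorted leq d -> (forall i, (tnth v (s i) <= tnth d i)%N) ->
  forall i, (tnth v i <= tnth d i)%N.
Proof.
move=> vs ds vd i.
have tmono (w : q.-tuple nat) : sorted leq w -> forall j k : 'I_q, (j <= k)%N ->
  (tnth w j <= tnth w k)%N.
  move=> ws j k jk; rewrite !(tnth_nth 0%N).
  apply: (sorted_leq_nth leq_trans leqnn 0%N ws) => //;
    by rewrite inE size_tuple ltn_ord.
have [j ji isj] : exists2 j : 'I_q, (j <= i)%N & (i <= s j)%N.
  apply: contrapT => /forall2NP nj.
  pose A := [set j : 'I_q | (j <= i)%N]%SET;
    pose B := [set j : 'I_q | (j < i)%N]%SET.
  have sub : s @: A \subset B.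
    apply/fintype.subsetP => k /imsetP[j]; rewrite !inE => ji ->.
    by have [//|/negP] := nj j; rewrite -ltnNge.
  have := subset_leq_card sub; rewrite card_imset; last exact: perm_inj.
  suff : (#|B| < #|A|)%N by rewrite ltnNge => /negP.
  apply: proper_card; apply/fintype.properP; split; last by exists i;
    rewrite inE ?ltnn.
  by apply/fintype.subsetP => k; rewrite !inE => /ltnW.
exact: leq_trans (tmono v vs _ _ isj) (leq_trans (vd j) (tmono d ds _ _ ji)).
Qed.

(** * Invariants along a line *)

Section Invariants.
Variables (K : numClosedFieldType) (g V : vectType K)
  (rho : {linear g -> 'End(V)}).
Variables (n q : nat) (e : n.-tuple V) (f : q.-tuple {mpoly K[n]}).
Hypothesis e_basis : basis_of {:V} e.
Hypothesis f_inv : forall i, invariant_poly e rho (tnth f i).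

Local Notation D := (dependent_locus e f).
Local Notation ev t := (map_mx (horner_eval t)).
Local Notation omega c := (\det (colsub c (jacobian f))).

Lemma dim_V : n = \dim {:V}.
Proof. by rewrite -(span_basis e_basis)
  (eqnP (basis_free e_basis)) size_tuple. Qed.

Lemma meval_omega (c : 'I_q -> 'I_n) x :
  (omega c).@[x] = \det (colsub c (jacobian_at f x)).
Proof. by rewrite -det_map_mx map_mxsub. Qed.

Lemma dependent_locus_omega x : D x <-> forall c, (omega c).@[coords e x] = 0.
Proof.
rewrite (dependent_locusE e_basis); split=> [Nfree c|om0].
  rewrite meval_omega; apply: contrapT => /eqP c0; move/negP: Nfree; apply.
  by apply/row_free_minor; exists c.
by apply/negP => /row_free_minor[c]; rewrite -meval_omega om0 eqxx.
Qed.

(** Entry (i, k) is the value of df_i at x + t y on the k-th vector of eW,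
as a polynomial in t. *)
Definition line_mx N (eW : N.-tuple V) (x y : 'I_n -> K) :
  'M[{poly K}]_(q, N) :=
  \matrix_(i, k) \sum_j (coord e j eW`_k)%:P * line x y (tnth f i)^`M(j).

Lemma ev_line_mx N (eW : N.-tuple V) x y t :
  ev t (line_mx eW x y) =
    jacobian_at f (fun i => x i + t * y i) *m \matrix_(j, k) coord e j eW`_k.
Proof.
apply/matrixP => i k; rewrite !mxE /horner_eval horner_sum; apply: eq_bigr =>
  j _.
by rewrite !mxE hornerM hornerC horner_line mulrC.
Qed.

Lemma row_free_line_mx N (eW : N.-tuple V) x y t : basis_of {:V} eW ->
  row_free (ev t (line_mx eW x y)) = row_free
    (jacobian_at f (fun i => x i + t * y i)).
Proof.
move=> bW; rewrite ev_line_mx /row_free mxrankMfree //.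
apply/row_freeP; exists (\matrix_(k, j) coord eW k e`_j); apply/matrixP => i j.
rewrite !mxE; under eq_bigr do rewrite !mxE mulrC.
have -> : (i == j)%:R = coord e i e`_j :> K by rewrite coord_free
  ?(basis_free e_basis) // eq_sym.
rewrite [in RHS](coord_basis bW (memvf e`_j)) linear_sum; apply: eq_bigr => k _.
by rewrite linearZ.
Qed.

Lemma line_mx_free N (eW : N.-tuple V) a b t : basis_of {:V} eW ->
  row_free (ev t (line_mx eW (coords e a) (coords e b))) <-> ~ D (a + t *: b).
Proof.
move=> bW; rewrite row_free_line_mx // (dependent_locusE e_basis).
have -> : jacobian_at f (fun i => coords e a i + t * coords e b i) =
    jacobian_at f (coords e (a + t *: b)).
  apply/matrixP => i j; rewrite !mxE; apply: meval_eq => k.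
  by rewrite (coords_line e).
by split=> [fr /negP|/negP]; rewrite ?negbK.
Qed.

Lemma size_line_mx N (eW : N.-tuple V) x y i k :
  (size (line_mx eW x y i k) <= degree (tnth f i))%N.
Proof.
rewrite mxE; apply: (leq_trans (size_sum _ _ _)); apply/bigmax_leqP => j _.
rewrite mul_polyC; apply: leq_trans (size_scale_leq _ _) _.
exact: leq_trans (size_line _ _ _) (msize_mderiv _ _).
Qed.

Lemma Rmap_line a b t : Rmap rho (a + t *: b) = Rmap rho a + t *: Rmap rho b.
Proof.
apply/lfunP => xi; rewrite add_lfunE scale_lfunE !RmapE.
by rewrite linearD linearZ.
Qed.

Lemma line_mx_kernel (bs : seq (jk_block K)) (a b : V)
  (eU : (jk_cols bs).-tuple g)
    (eW : (jk_rows bs).-tuple V) : basis_of {:V} eW ->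
  (forall t, lfun_mx eU eW (Rmap rho a + t *: Rmap rho b) = jk_mx t bs) ->
  forall t, ev t (line_mx eW (coords e a) (coords e b)) *m jk_mx t bs = 0.
Proof.
move=> bW E t; rewrite -E -Rmap_line; apply/matrixP => i l;
  rewrite ev_line_mx mxE [RHS]mxE.
rewrite -[RHS](f_inv i (a + t *: b) (tnth eU l)) -RmapE.
rewrite [X in differential _ _ _ X](coord_basis bW (memvf _)) linear_sum.
apply: eq_bigr => k _; rewrite linearZ /= differentialE mulrC mxE;
  congr (_ * _).
rewrite mxE; apply: eq_bigr => j _; rewrite !mxE; congr (_ * _).
by apply: meval_eq => i'; rewrite (coords_line e).
Qed.

Variable v : q.-tuple nat.

Lemma sum_heights (hs : seq nat) : perm_eq v hs ->
  (\sum_(i < q) tnth v i = \sum_(j < q) nth 0%N hs j)%N.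
Proof.
move=> vh; have szh : size hs = q by rewrite -(perm_size vh) size_tuple.
rewrite -(big_tuple _ _ v predT id) /= (perm_big _ vh) /= (big_nth 0%N) szh.
by rewrite big_mkord.
Qed.

Section OneLine.
Variables (bs : seq (jk_block K)) (a b : V).
Hypothesis ab_form : jk_form (Rmap rho a) (Rmap rho b) bs.
Hypothesis v_heights : perm_eq v (vertical_heights bs).

Let size_bs : size (vertical_heights bs) = q.
Proof. by rewrite -(perm_size v_heights) size_tuple. Qed.

(** One line suffices for both facts, provided that its starting point is
not in D. *)
Lemma line_degrees : ~ D a ->
  (exists s : 'S_q, forall i, (tnth v (s i) <= degree (tnth f i))%N) /\
  ((\sum_(i < q) degree (tnth f i) = \sum_(i < q) tnth v i)%N ->
     forall t, ~ D (a + t *: b)).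
Proof.
move=> Da; have [eU [eW [bU bW E]]] := ab_form.
have WK := line_mx_kernel bW E.
have [|[s sP] sumP] := pencil_degrees size_bs WK (size_line_mx eW _ _).
  by exists 0; apply/line_mx_free => //; rewrite scale0r addr0.
split=> [|sumE t]; last first.
  by apply/(line_mx_free a b t bW); apply: sumP; rewrite sumE; exact:
    sum_heights.
have /tuple_permP[p pE] : perm_eq (vertical_heights bs) v by rewrite perm_sym.
exists (s * p)%g => i; rewrite permM; apply: leq_trans (sP i).
by rewrite pE -tnth_nth tnth_mktuple.
Qed.

(** The reversed line b + t a supplies the matrix V of pencil_degrees_sum. *)
Lemma homogeneous_line_degrees :
  (forall i, tnth f i \is (degree (tnth f i)).-homog) ->
  (forall t, ~ D (a + t *: b)) -> ~ D b ->
  (\sum_(i < q) degree (tnth f i) = \sum_(i < q) tnth v i)%N.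
Proof.
move=> fhom lineD Db; have [eU [eW [bU bW E]]] := ab_form.
have WK := line_mx_kernel bW E.
rewrite (sum_heights v_heights).
apply: (pencil_degrees_sum size_bs
  (V := line_mx eW (coords e b) (coords e a)) WK).
- by move=> t; apply/line_mx_free.
- move=> i; have [|[s sP] _] := line_degrees.
    by have := lineD 0; rewrite scale0r addr0.
  apply: leq_trans (sP i).
  have : tnth v (s i) \in vertical_heights bs by rewrite -(perm_mem v_heights)
    mem_tnth.
  by move=> /(nthP 0%N)[j jlt <-]; exact: vertical_heights_gt0.
- move=> t i k t0; rewrite !mxE !horner_sum mulr_sumr; apply: eq_bigr => j _.
  rewrite !hornerM !hornerC !horner_line mulrCA; congr (_ * _).
  apply: dhomog_meval; first exact: dhomog_mderiv.
  by move=> l; rewrite mulrDr mulrA mulfV // mul1r addrC.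
- by apply/line_mx_free => //; rewrite scale0r addr0.
Qed.

End OneLine.

End Invariants.

(** * Generic lines and the equivalences *)

Section GenericPairs.
Variables (K : numClosedFieldType) (g V : vectType K)
  (rho : {linear g -> 'End(V)}).
Variables (n q : nat) (e : n.-tuple V) (v : q.-tuple nat).
Hypothesis e_basis : basis_of {:V} e.

(** The open set in the definition of the vertical indices contains the
complement of a hypersurface. *)
Lemma generic_pencil : vertical_indices e rho v ->
  exists2 G : {mpoly K[n + n]}, G != 0
    & forall a b, G.@[pair_coords e (a, b)] != 0 ->
    exists2 bs, jk_form (Rmap rho a) (Rmap rho b) bs
      & perm_eq v (vertical_heights bs).
Proof.
case=> O [ts [[S SE] [[a0 b0] Oab0] Oform vts]].
have [G [SG G0]] : exists p, S p /\ p.@[pair_coords e (a0, b0)] != 0.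
  apply: contrapT => /forallNP NS.
  have : (~` O) (a0, b0); last by move/(_ Oab0).
  rewrite SE /= => p Sp; apply: contrapT => /eqP p0; exact: (NS p).
exists G; first by apply: contraNneq G0 => ->; rewrite meval0.
move=> a b Gab; have Oab : O (a, b).
  apply: contrapT => NO; have : (~` O) (a, b) by [].
  by rewrite SE /= => /(_ G SG) /eqP; rewrite (negPf Gab).
have [bs abform bts] := Oform a b Oab; exists bs => //.
by rewrite (perm_trans vts) // -bts vertical_heights_type.
Qed.

(** A product of nonzero polynomials on V x V has a point where it does not
vanish. *)
Lemma pick_pair (G : {mpoly K[n + n]}) (H1 H2 : {mpoly K[n]}) :
  G != 0 -> H1 != 0 -> H2 != 0 -> exists a b,
  [/\ G.@[pair_coords e (a, b)] != 0, H1.@[coords e a] != 0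
    & H2.@[coords e b] != 0].
Proof.
pose l1 : n.-tuple {mpoly K[n + n]} := [tuple 'X_(lshift n i) | i < n].
pose l2 : n.-tuple {mpoly K[n + n]} := [tuple 'X_(rshift n i) | i < n].
have l1E H z : (H \mPo l1).@[z] = H.@[fun i => z (lshift n i)].
  by rewrite comp_mpoly_meval; apply: meval_eq => i;
    rewrite tnth_mktuple mevalXU.
have l2E H z : (H \mPo l2).@[z] = H.@[fun i => z (rshift n i)].
  by rewrite comp_mpoly_meval; apply: meval_eq => i;
    rewrite tnth_mktuple mevalXU.
move=> G0 /mpoly_nonroot[x1 x1P] /mpoly_nonroot[x2 x2P].
pose z12 (k : 'I_(n + n)) := match split k with inl i => x1 i | inr i =>
  x2 i end.
have L1 : H1 \mPo l1 != 0.
  apply: contraNneq x1P => E; have := l1E H1 z12; rewrite E meval0 => /esym.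
  rewrite (meval_eq (v2 := x1)) => [->//|i].
  by rewrite /z12 (unsplitK (inl i)).
have L2 : H2 \mPo l2 != 0.
  apply: contraNneq x2P => E; have := l2E H2 z12; rewrite E meval0 => /esym.
  rewrite (meval_eq (v2 := x2)) => [->//|i].
  by rewrite /z12 (unsplitK (inr i)).
have [z] := mpoly_nonroot (mulf_neq0 (mulf_neq0 G0 L1) L2).
rewrite !mevalM l1E l2E !mulf_eq0 !negb_or => /andP[/andP[Gz H1z] H2z].
have [a [b [abz az bz]]] := pair_coords_surj e_basis z.
by exists a, b; rewrite (meval_eq _ abz) (meval_eq _ az) (meval_eq _ bz).
Qed.

(** The polynomial p(a + b) - p(a) on V x V; where it is nonzero, p has a
zero on the line a + t b. *)
Definition increment (p : {mpoly K[n]}) : {mpoly K[n + n]} :=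
  (p \mPo [tuple 'X_(lshift n i) + 'X_(rshift n i) | i < n])
  - (p \mPo [tuple 'X_(lshift n i) | i < n]).

Lemma meval_increment p a b :
  (increment p).@[pair_coords e (a, b)] =
    p.@[fun i => coords e a i + coords e b i] - p.@[coords e a].
Proof.
rewrite mevalB !comp_mpoly_meval; congr (_ - _); apply: meval_eq => i;
  rewrite tnth_mktuple ?mevalD !mevalXU /pair_coords.
  by rewrite (unsplitK (inl i)) (unsplitK (inr i)).
by rewrite (unsplitK (inl i)).
Qed.

Lemma increment_neq0 p : prime_element p -> increment p != 0.
Proof.
move=> /nonconstant_values[x [b xb]].
have [a aE] := coords_surj e_basis x; have [b' bE] := coords_surj e_basis b.
apply: contraNneq xb => E; have := meval_increment p a b'; rewrite E meval0 =>
  /esym/eqP.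
rewrite subr_eq0 (meval_eq _ aE) => /eqP <-; apply/eqP/meval_eq => i.
by rewrite aE bE.
Qed.

End GenericPairs.

Section Equivalences.
Variables (K : numClosedFieldType) (g V : vectType K)
  (rho : {linear g -> 'End(V)}).
Variables (m n q : nat) (eg : m.-tuple g) (e : n.-tuple V)
  (f : q.-tuple {mpoly K[n]}).
Variables (v : q.-tuple nat) (d : {mpoly K[n]}).
Hypotheses (eg_basis : basis_of {:g} eg) (e_basis : basis_of {:V} e).
Hypothesis d_gcd : is_gcd (nonzero_minors eg e rho) d.
Hypothesis q_codim : q = codim_Oreg rho.
Hypothesis f_inv : forall i, invariant_poly e rho (tnth f i).
Hypothesis f_indep : alg_independent f.
Hypothesis v_vertical : vertical_indices e rho v.

Local Notation D := (dependent_locus e f).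
Local Notation omega c := (\det (colsub c (jacobian f))).
Local Notation r := (dim_Oreg rho).

Lemma omega_neq0 : exists c : 'I_q -> 'I_n, omega c != 0.
Proof.
have [x /row_free_minor[c cx]] := jacobian_criterion f_indep.
by exists c; apply: contraNneq cx => E; rewrite -meval_omega E meval0.
Qed.

(** D is the set of common zeros of the q x q minors of the Jacobian. *)
Lemma codim_dependent_locus : codim_ge (coords e) 2 D <->
  forall p, prime_element p -> ~ forall c : 'I_q -> 'I_n, divides p (omega c).
Proof.
have surj := coords_surj e_basis; split=> [codD p pp pom|copr].
  apply: (codim_ge2_no_hypersurface surj pp codD) => x px.
  by apply/dependent_locus_omega => // c; apply: divides_hypersurface px.
have [c0 omc0] := omega_neq0.
apply: (coprime_codim_ge2 surj
  (S := [set w | exists c : 'I_q -> 'I_n, w = omega c])).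
- by exists (omega c0) => //; exists c0.
- by move=> p pp pom; apply: (copr p pp) => c; apply: pom; exists c.
- by move=> _ [c ->] x /dependent_locus_omega; apply.
Qed.

Lemma exists_good_line (G : {mpoly K[n + n]}) : G != 0 -> exists a b bs,
  [/\ G.@[pair_coords e (a, b)] != 0, ~ D a,
      jk_form (Rmap rho a) (Rmap rho b) bs
    & perm_eq v (vertical_heights bs)].
Proof.
move=> G0; have [G' G'0 G'P] := generic_pencil v_vertical.
have [c omc] := omega_neq0.
have [a [b []]] := pick_pair e_basis (mulf_neq0 G0 G'0) omc omc.
rewrite mevalM mulf_eq0 negb_or => /andP[Gab /G'P[bs abform vbs]] oma _.
exists a, b, bs; split=> // /dependent_locus_omega - /(_ e_basis c) /eqP.
by rewrite (negPf oma).
Qed.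

Lemma degrees_ge : sorted leq [seq degree p | p <- f] -> sorted leq v ->
  forall i, (tnth v i <= degree (tnth f i))%N.
Proof.
move=> fs vs; have [a [b [bs [_ Da abform vbs]]]] := exists_good_line
  (oner_neq0 _).
have [[s sP] _] := line_degrees e_basis f_inv abform vbs Da.
pose df := [tuple degree (tnth f i) | i < q].
have dfE i : tnth df i = degree (tnth f i) by rewrite tnth_mktuple.
have dfs : sorted leq df.
  suff -> : df = map_tuple (@degree K n) f by [].
  by apply: eq_from_tnth => i; rewrite dfE tnth_map.
move=> i; rewrite -dfE; apply: (sorted_matching (s := s)) => // j.
by rewrite dfE.
Qed.

(** A generic line meets the hypersurface of a prime p, but it misses D when
the sums agree; so p cannot divide all the minors of the Jacobian. *)
Lemma sum_eq_codim :
  (\sum_(i < q) degree (tnth f i) = \sum_(i < q) tnth v i)%N ->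
    codim_ge (coords e) 2 D.
Proof.
move=> sumE; apply/codim_dependent_locus => p pp pom.
have [a [b [bs [+ Da abform vbs]]]] := exists_good_line
  (increment_neq0 e_basis pp).
rewrite meval_increment subr_eq0 => /line_root[t pt].
have [_ /(_ sumE t) []] := line_degrees e_basis f_inv abform vbs Da.
apply/dependent_locus_omega => // c.
have [k ->] := pom c; rewrite mevalM
  (meval_eq (v2 := fun i => coords e a i + t * coords e b i)).
  by rewrite pt mul0r.
by move=> i; rewrite coords_line.
Qed.

(** Let omega c0 be a nonzero minor. A point of D on the line is a zero of
one of its finitely many prime factors p, and p does not divide some
other minor omega c: elimination in direction b excludes their common
zeros for generic a. *)
Lemma lines_avoid_dependent_locus b : codim_ge (coords e) 2 D ->
  exists2 h : {mpoly K[n]}, h != 0 & forall a, h.@[coords e a] != 0 ->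
    forall t, ~ D (a + t *: b).
Proof.
move=> /codim_dependent_locus copr; have [c0 om0] := omega_neq0.
have [u [s [uu sP omE]]] := mpoly_factorial om0.
have [h h0 hP] : exists2 h : {mpoly K[n]}, h != 0
  & forall a t, h.@[coords e a] != 0 ->
    forall p, p \in s -> p.@[coords e (a + t *: b)] = 0 ->
    exists c : 'I_q -> 'I_n, (omega c).@[coords e (a + t *: b)] != 0.
  elim: s {omE} sP => [|p s IHs] sP; first by exists 1; rewrite ?oner_neq0.
  have [h h0 hP] : exists2 h : {mpoly K[n]}, h != 0
    & forall a t, h.@[coords e a] != 0 ->
    forall p, p \in s -> p.@[coords e (a + t *: b)] = 0 ->
    exists c : 'I_q -> 'I_n, (omega c).@[coords e (a + t *: b)] != 0.
    by apply: IHs => x xs; apply: sP; rewrite in_cons xs orbT.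
  have pp : prime_element p by apply: sP; rewrite mem_head.
  have /existsNP[c pNc] := copr p pp.
  have [k k0 kP] := line_elimination (coords e b) pp pNc.
  exists (k * h); first by rewrite mulf_neq0.
  move=> a t; rewrite mevalM mulf_eq0 negb_or => /andP[ka ha] p'.
  have lineE (w : {mpoly K[n]}) :
    w.@[coords e (a + t *: b)] = w.@[fun i => coords e a i + t * coords e b i].
    by apply: meval_eq => i; rewrite coords_line.
  rewrite in_cons => /predU1P[->|]; last exact: hP.
  move=> pa; exists c; apply: contraNneq ka => ca.
  by rewrite (kP (coords e a) t) // -lineE.
exists h => // a ha t Dab; have := omE =>
  /(congr1 (meval (coords e (a + t *: b)))).
have /(_ c0) -> := (dependent_locus_omega f e_basis (a + t *: b)).1 Dab.
rewrite mevalM rmorph_prod /= => /esym/eqP; rewrite mulf_eq0 => /orP[/eqP u0|].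
  by have /= := rmorph_unit (meval (coords e (a + t *: b))) uu;
    rewrite u0 unitr0.
rewrite prodf_seq_eq0 => /hasP[p ps /= /eqP pab].
have [c] := hP a t ha p ps pab.
by have -> := (dependent_locus_omega f e_basis (a + t *: b)).1 Dab c;
  rewrite eqxx.
Qed.

(** The point b is fixed first, outside D and generic for the pencil; then a
is generic both for the pencil with this b and for the line to miss D. *)
Lemma homogeneous_codim_sum :
  (forall i, tnth f i \is (degree (tnth f i)).-homog) ->
  codim_ge (coords e) 2 D ->
  (\sum_(i < q) degree (tnth f i) = \sum_(i < q) tnth v i)%N.
Proof.
move=> fhom codD; have [G G0 GP] := generic_pencil v_vertical.
have [c omc] := omega_neq0.
have [a0 [b [Gb _ omb]]] := pick_pair e_basis G0 omc omc.
have [h h0 hP] := lines_avoid_dependent_locus b codD.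
pose Gb' : {mpoly K[n]} :=
  G \mPo [tuple match split k with inl i => 'X_i | inr i =>
    (coords e b i)%:MP end | k < n + n].
have Gb'E a : Gb'.@[coords e a] = G.@[pair_coords e (a, b)].
  rewrite comp_mpoly_meval; apply: meval_eq => k;
    rewrite tnth_mktuple /pair_coords.
  by case: split => i; rewrite ?mevalXU ?mevalC.
have Gb'0 : Gb' != 0 by apply: contraNneq Gb => E; rewrite -Gb'E E meval0.
have [x] := mpoly_nonroot (mulf_neq0 Gb'0 h0).
have [a aE] := coords_surj e_basis x.
rewrite -(meval_eq _ aE) mevalM mulf_eq0 negb_or Gb'E =>
  /andP[/GP[bs abform vbs] ha].
apply: (homogeneous_line_degrees e_basis f_inv abform vbs fhom (hP a ha)).
by move=> /dependent_locus_omega - /(_ e_basis c) /eqP; rewrite (negPf omb).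
Qed.

Lemma Rmx_at x : map_mx (meval (coords e x)) (Rmx eg e rho) = lfun_mx eg e
  (Rmap rho x).
Proof.
apply/matrixP => i j; rewrite !mxE rmorph_sum /= RmapE.
rewrite {2}(coord_basis e_basis (memvf x)) !linear_sum /=; apply: eq_bigr =>
  k _.
by rewrite mevalZ mevalXU mxE RmapE !linearZ /= mulrC -tnth_nth.
Qed.

Lemma dim_Oreg_attained : exists x, \dim (limg (Rmap rho x)) = r.
Proof.
rewrite /dim_Oreg.
pose P (k : 'I_(\dim {:V}).+1) := `[< exists x, \dim (limg (Rmap rho x)) = k >].
have : (0 < #|[pred k | P k]|)%N.
  apply/card_gt0P; have lt : (\dim (limg (Rmap rho 0)) < (\dim {:V}).+1)%N.
    by rewrite ltnS dimvS ?subvf.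
  by exists (Ordinal lt); rewrite inE; exists (0 : V).
case/(eq_bigmax_cond (fun k : 'I__ => k : nat)) => k; rewrite inE => -[x xk] E.
by exists x; rewrite xk -E.
Qed.

Lemma dim_codim_Oreg : n = (q + r)%N.
Proof.
rewrite q_codim /codim_Oreg -(dim_V e_basis) subnK //.
by have [x <-] := dim_Oreg_attained; rewrite (dim_V e_basis) dimvS ?subvf.
Qed.

Lemma exists_nonzero_minor : exists p, nonzero_minors eg e rho p.
Proof.
have [x xr] := dim_Oreg_attained.
have := exists_sorted_minor (lfun_mx eg e (Rmap rho x)).
rewrite dim_limg_lfun_mx // xr => -[I [J [Iinc Jinc IJ]]].
exists (\det (mxsub I J (Rmx eg e rho))); split; last by exists I, J.
apply: contraNneq IJ => E.
by rewrite -Rmx_at -map_mxsub det_map_mx E rmorph0.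
Qed.

Lemma gcd_neq0 : d != 0.
Proof.
have [p pm] := exists_nonzero_minor; have [dd _] := d_gcd.
by have [p0 _] := pm; have [c pE] := dd p pm; apply: contraNneq p0 => d0;
  rewrite pE d0 mul0r.
Qed.

(** A prime dividing all the quotients h could be absorbed in the gcd. *)
Lemma Sing1_codim : codim_ge (coords e) 2 (Sing1 eg e rho d).
Proof.
have [dd dmax] := d_gcd; have [p pm] := exists_nonzero_minor.
apply: (coprime_codim_ge2 (coords_surj e_basis)
  (S := [set h | nonzero_minors eg e rho (d * h)])).
- have [h pE] := dd p pm; exists h; first by rewrite /= -pE.
  by have [p0 _] := pm; apply: contraNneq p0 => h0; rewrite pE h0 mulr0.
- move=> p' pp' p'h; have p'd : mpdvd (d * p') d.
    apply: dmax => p1 p1m; have [h p1E] := dd p1 p1m.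
    have [k hE] : divides p' h by apply: p'h; rewrite /= -p1E.
    by exists k; rewrite p1E hE mulrA.
  apply: (prime_not_divides_unit pp' (unitr1 _)).
  apply: (divides_pmul2l gcd_neq0); by rewrite mulr1.
- by move=> h hm x; apply.
Qed.

(** The Jacobian kills any r columns of the matrix of R_x, so
annihilated_minor_divisible applies. *)
Lemma codim_sub_Sing1 : codim_ge (coords e) 2 D -> D `<=` Sing1 eg e rho d.
Proof.
move=> /codim_dependent_locus copr x Dx h [p0 [I [J [Iinc Jinc hE]]]].
have [dd _] := d_gcd.
pose Y := colsub J (Rmx eg e rho).
have XY : jacobian f *m Y = 0.
  apply/matrixP => i j; rewrite [RHS]mxE; apply: mpoly_eq0_meval => y.
  have [w wE] := coords_surj e_basis y; rewrite -(meval_eq _ wE).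
  rewrite mxE rmorph_sum -[RHS](f_inv i w (tnth eg (J j))) differentialE /=.
  apply: eq_bigr => k _; rewrite mevalM !mxE; congr (_ * _).
  have := Rmx_at w => /matrixP/(_ k (J j)); rewrite !mxE => ->.
  by rewrite RmapE.
have dY (I' : 'I_r -> 'I_n) : divides d (\det (rowsub I' Y)).
  have YE (I1 : 'I_r -> 'I_n) : rowsub I1 Y = mxsub I1 J (Rmx eg e rho).
    by apply/matrixP => i j; rewrite !mxE.
  rewrite YE; apply: divides_all_minors => I1 I1inc.
  have [->|N0] := eqVneq (\det (mxsub I1 J (Rmx eg e rho))) 0.
    exact: divides0.
  by apply: dd; split=> //; exists I1, J.
have hE' : d * h = \det (rowsub I Y).
  by rewrite hE; congr (\det _); apply/matrixP => i j; rewrite !mxE.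
have [k ->] := annihilated_minor_divisible dim_codim_Oreg
  (@mpoly_factorial K n) XY gcd_neq0 omega_neq0 copr dY hE'.
rewrite mevalM -det_map_mx map_castmx map_col_mx.
by rewrite det_stack_dependent ?mul0r //; apply/dependent_locusE.
Qed.

End Equivalences.

Local Open Scope complex_scope.

Theorem theorem5p6 (R : realType) (g V : vectType R[i]) (br : g -> g -> g)
    (rho : {linear g -> 'End(V)}) (m n q : nat)
    (eg : m.-tuple g) (e : n.-tuple V) (p_rho : {mpoly R[i][n]})
    (f : q.-tuple {mpoly R[i][n]}) (v : q.-tuple nat)
    (br_lie : lie_bracket br) (rho_repr : lie_representation br rho)
    (eg_basis : basis_of {:g} eg) (e_basis : basis_of {:V} e)
    (p_rho_gcd : is_gcd (nonzero_minors eg e rho) p_rho)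
    (q_codim : q = codim_Oreg rho)
    (f_inv : forall i, invariant_poly e rho (tnth f i))
    (f_indep : alg_independent f)
    (f_sorted : sorted leq [seq degree p | p <- f])
    (v_vertical : vertical_indices e rho v)
    (v_sorted : sorted leq v) :
  let cond1 := forall i, degree (tnth f i) = tnth v i in
  let cond2 := (\sum_(i < q) degree (tnth f i) = \sum_(i < q) tnth v i)%N in
  let cond3 := codim_ge (coords e) 2 (dependent_locus e f) in
  let cond4 := dependent_locus e f `<=` Sing1 eg e rho p_rho in
  ((forall i, tnth f i \is (degree (tnth f i)).-homog) ->
     [<-> cond1; cond2; cond3; cond4]) /\
  [/\ cond1 <-> cond2, cond2 -> cond3 & cond3 <-> cond4].
Proof.
move=> cond1 cond2 cond3 cond4.
have ge_v := degrees_ge e_basis f_inv f_indep v_vertical f_sorted v_sorted.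
have c12 : cond1 -> cond2 by move=> eq_v; apply: eq_bigr => i _; exact: eq_v.
have c21 : cond2 -> cond1.
  move=> sum_eq i.
  have := leqif_sum (P := predT) (fun j _ => leqif_eq (ge_v j)).
  case=> _; rewrite sum_eq eqxx => /esym/forall_inP/(_ i isT) /eqP.
  exact: esym.
have c23 : cond2 -> cond3 := sum_eq_codim e_basis f_inv f_indep v_vertical.
have c34 : cond3 -> cond4 :=
  codim_sub_Sing1 eg_basis e_basis p_rho_gcd q_codim f_inv f_indep.
have c43 : cond4 -> cond3.
  by move/codim_geS; apply; exact: Sing1_codim eg_basis e_basis p_rho_gcd.
have c32 f_hom : cond3 -> cond2 :=
  homogeneous_codim_sum e_basis f_inv f_indep v_vertical f_hom.
split=> [f_hom|]; last by split=> //; split.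
by tfae=> // /c43/(c32 f_hom)/c21.
Qed.
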